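(* Let $n\ge1$ be an integer, $q>0$ and $\alpha\in\mathbb R$. Let $$G^{(q,\alpha)}=\left(\int_0^1 A_{i-1}^{(q,\alpha)}(x)\,A_{j-1}^{(q,\alpha)}(x)\,dx\right)_{1\le i,j\le n+1}$$ be the Gramian matrix of the $q$-Abel basis $(A_0^{(q,\alpha)},\dots,A_n^{(q,\alpha)})$ with respect to the inner product $\langle p,r\rangle=\int_0^1p(x)r(x)\,dx$. If $\alpha\le0$, the Gramian matrix $G^{(q,\alpha)}$ is strictly totally positive. Moreover, $G^{(q,\alpha)}$ and its bidiagonal decomposition can be computed to high relative accuracy (HRA). Consequently, the eigenvalues, singular values and the inverse matrix of $G^{(q,\alpha)}$, as well as the solution of linear systems $G^{(q,\alpha)}c=d$, where the entries of $d=(d_1,\dots,d_{n+1})^T$ have alternating signs, can be computed to HRA.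
   Context: For $q>0$ and $m\ge 1$ let $[m]=\sum_{i=0}^{m-1}q^i$. The $q$-Abel polynomials are $A_0^{(q,\alpha)}(x)=1$ and $A_m^{(q,\alpha)}(x)=x\prod_{j=1}^{m-1}(xq^j-\alpha[m])$ for $m\ge1$. A real matrix is strictly totally positive (STP) if all its minors are positive, and totally positive (TP) if all its minors are nonnegative. Neville elimination of a nonsingular $(n+1)\times(n+1)$ matrix $A$: $A^{(1)}=A$, and $A^{(k+1)}$ is obtained from $A^{(k)}$ by $a^{(k+1)}_{i,j}=a^{(k)}_{i,j}-\frac{a^{(k)}_{i,k}}{a^{(k)}_{i-1,k}}a^{(k)}_{i-1,j}$ for $i\ge k+1$, $j\ge k$ when $a^{(k)}_{i-1,k}\neq 0$, other entries being unchanged. Its multipliers are $m_{i,j}=a^{(j)}_{i,j}/a^{(j)}_{i-1,j}$ (or $0$ if $a^{(j)}_{i-1,j}=0$), $1\le j<i\le n+1$, and its diagonal pivots are $p_{i,i}=a^{(i)}_{i,i}$. A nonsingular TP matrix has the bidiagonal decomposition $A=F_n\cdots F_1DG_1\cdots G_n$, where $D=\mathrm{diag}(p_{1,1},\dots,p_{n+1,n+1})$, $F_i$ is unit lower bidiagonal with $(r,r-1)$ entry $0$ for $r\le i$ and $m_{r,r-i}$ for $r\ge i+1$, and $G_i^T$ has the same form with the multipliers $\widetilde m_{i,j}$ of the Neville elimination of $A^T$. High relative accuracy (HRA): a real value $t$ is computed with HRA if the computed value $\tilde t$ satisfies $|t-\tilde t|/|t|<Ku$, where $u$ is the unit round-off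 of the floating point arithmetic and $K>0$ is a constant independent of the arithmetic precision; a matrix, vector or factorization is computed to HRA when its entries are. A sufficient condition for HRA is the no inaccurate cancellation condition: the algorithm only evaluates products, quotients, sums of numbers of the same sign, subtractions of numbers of opposite sign, or subtractions of initial data. The initial data here are $q$, $\alpha$ (and $d$ for linear systems). *)

(* Defs.v *)
(* MathComp / MathComp-Analysis. *)
From HB Require Import structures.
From mathcomp Require Import all_boot all_order all_algebra.
From mathcomp Require Import all_classical all_reals all_analysis.
Set Implicit Arguments.
Unset Strict Implicit.
Unset Printing Implicit Defensive.
Import Order.TTheory GRing.Theory Num.Theory.
Local Open Scope classical_set_scope.
Local Open Scope ring_scope.

Definition qint (R : realType) (q : R) (m : nat) : R := \sum_(i < m) q ^+ i.

Definition qAbel (R : realType) (q alpha : R) (m : nat) : {poly R} :=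
  if m is 0 then 1
  else 'X * \prod_(1 <= j < m) (q ^+ j *: 'X - (alpha * qint q m)%:P).

(* Rows and columns are indexed from 0, so entry (i, j) pairs A_i with A_j. *)
Definition gram (R : realType) (n : nat) (q alpha : R) : 'M[R]_n.+1 :=
  \matrix_(i, j)
    (\int[@lebesgue_measure R]_(x in `[0, 1])
        ((qAbel q alpha i).[x] * (qAbel q alpha j).[x])).

Definition strictly_totally_positive (R : realType) (m : nat) (A : 'M[R]_m) :=
  forall (k : nat) (f g : 'I_k -> 'I_m),
    {homo f : i j / (i < j)%N} -> {homo g : i j / (i < j)%N} ->
    0 < \det (mxsub f g A).

Section Neville.
Context (R : realType) (n : nat).
Implicit Types A : 'M[R]_n.+1.

Definition prev_row (i : 'I_n.+1) : 'I_n.+1 := inord i.-1.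

(* Rows, columns and steps are numbered from 0: step k creates zeros in
   column k below the diagonal, and [neville A k] is A^(k+1). *)
Definition neville_step (k : nat) A : 'M[R]_n.+1 :=
  \matrix_(i, j)
    (if [&& (k < i)%N, (k <= j)%N & A (prev_row i) (inord k) != 0]
     then A i j - A i (inord k) / A (prev_row i) (inord k) * A (prev_row i) j
     else A i j).

Fixpoint neville A (k : nat) : 'M[R]_n.+1 :=
  if k is k'.+1 then neville_step k' (neville A k') else A.

(* Division by 0 returns 0, as the convention for multipliers requires. *)
Definition multiplier A (i j : 'I_n.+1) : R :=
  neville A j i j / neville A j (prev_row i) j.

Definition pivot A (i : 'I_n.+1) : R := neville A i i i.

(* For 1 <= i <= n.  With 1-based r, entry (r, r-1) is 0 if r <= i and
   m_(r, r-i) otherwise; the 0-based row number below is r - 1. *)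
Definition bd_lower A (i : nat) : 'M[R]_n.+1 :=
  \matrix_(r, c)
    (if r == c then 1
     else if ((c.+1 == r) && (i <= r))%N then multiplier A r (inord (r - i))
     else 0).

Definition bd_diag A : 'M[R]_n.+1 := diag_mx (\row_i pivot A i).

(* F_n, ..., F_1, D, G_1, ..., G_n *)
Definition bd_factors A : seq 'M[R]_n.+1 :=
  [seq bd_lower A i | i <- rev (iota 1 n)]
    ++ bd_diag A :: [seq (bd_lower A^T i)^T | i <- iota 1 n].

(* The t k are the factors of the bidiagonal decomposition of A. *)
Definition is_bidiagonal_decomposition A (t : 'I_(n + n.+1) -> 'M[R]_n.+1) :=
  (forall k, t k = nth 0 (bd_factors A) k) /\ A = \prod_k t k.

End Neville.

(* The real eigenvalues of A, with multiplicities, in decreasing order. *)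
Definition is_eigenvalues (R : realType) (m : nat) (A : 'M[R]_m)
    (lam : 'I_m -> R) :=
  char_poly A = \prod_i ('X - (lam i)%:P) /\
  {homo lam : i j / (i <= j)%N >-> j <= i}.

Definition is_singular_values (R : realType) (m : nat) (A : 'M[R]_m)
    (sigma : 'I_m -> R) :=
  [/\ forall i, 0 <= sigma i,
      {homo sigma : i j / (i <= j)%N >-> j <= i} &
      char_poly (A^T *m A) = \prod_i ('X - (sigma i ^+ 2)%:P)].

Definition alternating_signs (R : realType) (m : nat) (d : 'cV[R]_m) :=
  forall i j : 'I_m, i.+1 = j :> nat -> d i 0 * d j 0 < 0.

Inductive fp_op := FAdd | FSub | FMul | FDiv.

Definition exact_op (R : realType) (o : fp_op) (x y : R) : R :=
  match o with
  | FAdd => x + y | FSub => x - y | FMul => x * y | FDiv => x / y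
  end.

(* The standard model of floating point arithmetic, without overflow and
   underflow: every operation has relative error at most the unit round-off u.
   The bound u <= 1/2 holds for rounding to nearest in any base and with any
   number of digits, where u = base^(1 - digits) / 2. *)
Record fp_arith (R : realType) := FpArith {
  fp_u : R;
  fl_const : int -> R;
  fl_op : fp_op -> R -> R -> R;
  fl_sqrt : R -> R;
  fp_u_gt0 : 0 < fp_u;
  fp_u_le : fp_u <= 2^-1;
  fl_constP : forall z : int, `|fl_const z - z%:~R| <= fp_u * `|z%:~R|;
  fl_opP : forall o x y,
    `|fl_op o x y - exact_op o x y| <= fp_u * `|exact_op o x y|;
  fl_sqrtP : forall x : R, 0 <= x ->
    `|fl_sqrt x - Num.sqrt x| <= fp_u * `|Num.sqrt x|
}.

(* Algorithms are while-programs over finitely many of the registers 0, 1, ...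
   Their text is independent of the arithmetic they are run in; [EUnit] lets
   stopping criteria refer to the unit round-off. *)
Inductive expr :=
  | EReg of nat
  | EConst of int
  | EUnit
  | EOp of fp_op & expr & expr
  | ESqrt of expr.

Inductive program :=
  | PSkip
  | PAssign of nat & expr
  | PSeq of program & program
  | PIf of expr & expr & program & program
  | PWhile of expr & expr & program.

Definition store (R : realType) := nat -> R.

(* Division by 0 and square roots of negative numbers have no value. *)
Fixpoint eval (R : realType) (F : fp_arith R) (s : store R) (e : expr) :
    option R :=
  match e with
  | EReg k => Some (s k)
  | EConst z => Some (fl_const F z)
  | EUnit => Some (fp_u F)
  | EOp o e1 e2 =>
      match eval F s e1, eval F s e2 with
      | Some x, Some y =>
          if o is FDiv then (if y == 0 then None else Some (fl_op F o x y))
          else Some (fl_op F o x y)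
      | _, _ => None
      end
  | ESqrt e1 =>
      match eval F s e1 with
      | Some x => if x < 0 then None else Some (fl_sqrt F x)
      | None => None
      end
  end.

Definition set_reg (R : realType) (s : store R) (k : nat) (v : R) : store R :=
  fun i => if i == k then v else s i.

(* [exec F p s s']: run in the arithmetic F from the store s, the program p
   terminates without error in the store s'.  The guard of [PIf e1 e2] and
   [PWhile e1 e2] is e1 < e2; comparisons of computed values are exact. *)
Inductive exec (R : realType) (F : fp_arith R) :
    program -> store R -> store R -> Prop :=
  | exec_skip s : exec F PSkip s s
  | exec_assign s k e v :
      eval F s e = Some v -> exec F (PAssign k e) s (set_reg s k v)
  | exec_seq p1 p2 s1 s2 s3 :
      exec F p1 s1 s2 -> exec F p2 s2 s3 -> exec F (PSeq p1 p2) s1 s3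
  | exec_if_true e1 e2 p1 p2 s s' x y :
      eval F s e1 = Some x -> eval F s e2 = Some y -> x < y ->
      exec F p1 s s' -> exec F (PIf e1 e2 p1 p2) s s'
  | exec_if_false e1 e2 p1 p2 s s' x y :
      eval F s e1 = Some x -> eval F s e2 = Some y -> y <= x ->
      exec F p2 s s' -> exec F (PIf e1 e2 p1 p2) s s'
  | exec_while_true e1 e2 p s1 s2 s3 x y :
      eval F s1 e1 = Some x -> eval F s1 e2 = Some y -> x < y ->
      exec F p s1 s2 -> exec F (PWhile e1 e2 p) s2 s3 ->
      exec F (PWhile e1 e2 p) s1 s3
  | exec_while_false e1 e2 p s x y :
      eval F s e1 = Some x -> eval F s e2 = Some y -> y <= x ->
      exec F (PWhile e1 e2 p) s s.

(* A relative error bound for t = 0 means that 0 is computed exactly. *)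
Definition hra_value (R : realType) (K u t t' : R) :=
  if t == 0 then t' = 0 else `|t - t'| / `|t| < K * u.

(* The quantities t (indexed by J) specified by [target] from the data x can be
   computed to high relative accuracy.  Registers 0, 1, ... initially hold the
   initial data [input x], exactly, and all others hold 0; entry j of the
   result is read from register [out j].  The program and the constant K depend
   neither on the arithmetic nor on the data. *)
Definition hra_computable (R : realType) (X : Type) (J : finType)
    (input : X -> seq R) (dom : X -> Prop) (target : X -> (J -> R) -> Prop) :=
  exists (p : program) (out : J -> nat) (K : R), 0 < K /\
    forall x : X, dom x ->
      exists2 t : J -> R, target x t &
        forall F : fp_arith R,
          exists2 s : store R, exec F p (fun k => nth 0 (input x) k) s &
            forall j, hra_value K (fp_u F) (t j) (s (out j)).

Section Computability.
Context (R : realType).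

Definition qalpha_dom (x : R * R) := 0 < x.1 /\ x.2 <= 0.

Definition hra_from_q_alpha (J : finType)
    (target : R -> R -> (J -> R) -> Prop) :=
  hra_computable (fun x : R * R => [:: x.1; x.2]) qalpha_dom
    (fun x => target x.1 x.2).

Definition hra_from_q_alpha_d (m : nat) (dom : 'cV[R]_m -> Prop) (J : finType)
    (target : R -> R -> 'cV[R]_m -> (J -> R) -> Prop) :=
  hra_computable
    (fun x : R * R * 'cV[R]_m =>
       [:: x.1.1, x.1.2 & [seq x.2 i 0 | i <- enum 'I_m]])
    (fun x => qalpha_dom x.1 /\ dom x.2)
    (fun x => target x.1.1 x.1.2 x.2).

End Computability.

(* Main.v *)
Require Import Defs.
From HB Require Import structures.
From mathcomp Require Import all_boot all_order all_algebra all_fingroup.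
From mathcomp Require Import all_classical all_reals all_analysis.
From mathcomp Require Import complex spectral ring lra zify.
Import Order.TTheory GRing.Theory Num.Theory.
Import numFieldNormedType.Exports.
Local Open Scope classical_set_scope.
Local Open Scope ring_scope.
Set Implicit Arguments.
Unset Strict Implicit.
Unset Printing Implicit Defensive.

(* The Gramian is L H L^T, where the rows of L are the coefficients of the
   q-Abel polynomials and H is the Hilbert matrix.  Up to scaling L collects
   the values of Newton polynomials at the nodes -1/[r]; divided differences
   factor it into nonnegative bidiagonal matrices with subtraction-free entries.
   The minors of H are positive rationals, so Cauchy-Binet gives positive
   subtraction-free formulas for all minors of the Gramian G.

   Strict total positivity is then immediate, and the entries of G, of its
   inverse and of its bidiagonal decomposition are quotients of minors, up to
   sign; the sums solving G c = d have terms of one sign.  The eigenvalues need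
   an iteration: lam_1 ... lam_k is the spectral radius of the nonnegative k-th
   compound C of G, and the (2^j)-th root of the trace of C^(2^j) approximates
   it to relative accuracy of order 2^-j.  Repeated squaring multiplies relative
   errors by 2^j and the j square roots divide them by 2^j, so about log(1/u)
   steps give a relative error of order u, with a constant depending on n only.
   As G is symmetric positive definite, its singular values are its
   eigenvalues. *)

(** * Relative errors *)

(** Since n is fixed, programs may be as long as the number of minors requires; only the count of
    roundings must not depend on q, alpha, d and u. Apart from the eigenvalues and singular values,
    everything is straight-line code. For the eigenvalues the obstacle is uniformity: their gaps and
    the condition number are not bounded over the data, so the usual convergence rates of an
    iteration give no uniform constant. What is uniform is that C has nonnegative entries, so its
    powers are formed without cancellation, and that the trace of C^m lies between rho^m and N
    rho^m, with rho the spectral radius and N the order of C, whatever the gaps. This serves the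
    spectral radius only; hence one compound for each k, the eigenvalues being quotients of
    consecutive radii. The number of squarings must depend on u although the program text does not:
    a register growing from u to about 1 times the loop, and the same device times the square roots
    that undo it. As the accumulated error exponents may exceed 1/u on the way, errors are measured
    by powers of 1 - u, not to first order. *)

Section Approximation.
Context (R : realType) (F : fp_arith R).
Implicit Types (c : nat) (x y z t : R).
Local Notation v := (1 - fp_u F).

(** [c] counts roundings. With powers of 1 - u in place of 1 - c u and 1 + c u, exponents add
    exactly under products and halve under square roots, even when c u is large; zero is
    approximated by zero only. *)
Definition relapprox c x y :=
  exists2 t, v ^+ c <= t <= v ^- c & y = x * t.

Let u_gt0 : 0 < fp_u F := fp_u_gt0 F.

Lemma one_sub_u_ge_half : 2^-1 <= v.
Proof. have := fp_u_le F; lra. Qed.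

Let v_gt0 : 0 < v.
Proof. have := one_sub_u_ge_half; lra. Qed.

Let v_le1 : v <= 1.
Proof. by rewrite gerBl ltW. Qed.

Let vX_gt0 c : 0 < v ^+ c.
Proof. exact: exprn_gt0. Qed.

Let vXle c d : (c <= d)%N -> v ^+ d <= v ^+ c.
Proof. by move=> cd; rewrite ler_wiXn2l // ltW. Qed.

Lemma approx_refl c x : relapprox c x x.
Proof.
exists 1; last by rewrite mulr1.
have vc1 : v ^+ c <= 1 by rewrite exprn_ile1 // ltW.
by rewrite vc1 -[leLHS]invr1 lef_pV2 ?posrE ?vc1.
Qed.

Lemma approxW c d x y : (c <= d)%N -> relapprox c x y -> relapprox d x y.
Proof.
move=> cd [t /andP[t1 t2] ->]; exists t => //.
rewrite (le_trans (vXle cd) t1) (le_trans t2) //.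
by rewrite lef_pV2 ?posrE // vXle.
Qed.

Lemma approx_factor_gt0 c t : v ^+ c <= t -> 0 < t.
Proof. exact: lt_le_trans. Qed.

Lemma approx_trans c d x y z :
  relapprox c x y -> relapprox d y z -> relapprox (c + d) x z.
Proof.
move=> [t /andP[t1 t2] ->] [s /andP[s1 s2] ->]; exists (t * s); last first.
  by rewrite mulrA.
have [t0 s0] := (approx_factor_gt0 t1, approx_factor_gt0 s1).
rewrite exprD invfM ![v ^- c * _]mulrC ![_ * v ^- c]mulrC.
by rewrite !ler_pM // ?ltW.
Qed.

Lemma approx_gt0 c x y : relapprox c x y -> (0 < y) = (0 < x).
Proof.
by move=> [t /andP[t1 _] ->]; rewrite pmulr_lgt0 // (approx_factor_gt0 t1).
Qed.

Lemma approx_ge0 c x y : relapprox c x y -> (0 <= y) = (0 <= x).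
Proof.
by move=> [t /andP[t1 _] ->]; rewrite pmulr_lge0 // (approx_factor_gt0 t1).
Qed.

Lemma approx_eq0 c x y : relapprox c x y -> (y == 0) = (x == 0).
Proof.
move=> [t /andP[t1 _] ->]; rewrite mulf_eq0 orbC.
by rewrite gt_eqF // (approx_factor_gt0 t1).
Qed.

Lemma approxM c d x x' y y' :
  relapprox c x x' -> relapprox d y y' -> relapprox (c + d) (x * y) (x' * y').
Proof.
move=> [t ht ->] [s hs ->].
have [] : relapprox (c + d) 1 (t * s).
  by apply: (@approx_trans _ _ _ t); [exists t | exists s]; rewrite ?mul1r.
by move=> r hr; rewrite mul1r => e; exists r; rewrite // -e mulrACA.
Qed.

Lemma approxV c x y : relapprox c x y -> relapprox c x^-1 y^-1.
Proof.
move=> [t /andP[t1 t2] ->]; exists t^-1; last by rewrite invfM.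
have t0 := approx_factor_gt0 t1.
rewrite [X in _ && X]lef_pV2 ?posrE // t1 andbT.
by rewrite -[leLHS]invrK lef_pV2 ?posrE ?invr_gt0.
Qed.

Lemma approx_ge0P c x y : 0 <= x ->
  relapprox c x y <-> x * v ^+ c <= y <= x * v ^- c.
Proof.
rewrite le_eqVlt => /predU1P[<-|x0].
  rewrite !mul0r -eq_le; split=> [[t _ ->]|/eqP <-]; first by rewrite mul0r.
  exact: approx_refl.
split=> [[t ht ->]|]; first by rewrite !ler_pM2l.
move=> ht; exists (y / x); last by rewrite mulrC divfK ?gt_eqF.
by rewrite ler_pdivlMr // ler_pdivrMr // ![_ * x]mulrC.
Qed.

Lemma approxN c x y : relapprox c (- x) (- y) <-> relapprox c x y.
Proof.
by split=> -[t ht e]; exists t; rewrite // ?mulNr ?e //;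
  move: e; rewrite mulNr => /oppr_inj.
Qed.

Lemma approxD_ge0 c x x' y y' : 0 <= x -> 0 <= y ->
  relapprox c x x' -> relapprox c y y' -> relapprox c (x + y) (x' + y').
Proof.
move=> x0 y0 /(approx_ge0P _ _ x0)/andP[a b] /(approx_ge0P _ _ y0)/andP[d e].
by apply/approx_ge0P; [exact: addr_ge0 | rewrite !mulrDl !lerD].
Qed.

(** [0 <= x * y] excludes cancellation: terms of one sign share the enclosing factors, so the
    exponent does not grow. *)
Lemma approxD c x x' y y' : 0 <= x * y ->
  relapprox c x x' -> relapprox c y y' -> relapprox c (x + y) (x' + y').
Proof.
move=> xy ax ay; have [x0|x0] := ltP 0 x.
  by apply: approxD_ge0 => //; [exact: ltW | rewrite -(pmulr_rge0 _ x0)].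
have [y0|y0] := ltP 0 y.
  apply: approxD_ge0 => //; last exact: ltW.
  by rewrite -(pmulr_lge0 _ y0).
by apply/approxN; rewrite !opprD; apply: approxD_ge0;
  rewrite ?oppr_ge0 //; apply/approxN.
Qed.

Lemma approx_round x y : `|y - x| <= fp_u F * `|x| -> relapprox 1 x y.
Proof.
(* (1 + u)(1 - u) <= 1, so a rounding upwards also fits the symmetric enclosure. *)
have vV : 1 + fp_u F <= v^-1.
  rewrite -[leRHS]mul1r ler_pdivlMr //; have := sqr_ge0 (fp_u F); nra.
have pos a b : 0 <= a -> `|b - a| <= fp_u F * `|a| -> relapprox 1 a b.
  move=> a0; rewrite (ger0_norm a0) ler_norml => /andP[h1 h2].
  apply/approx_ge0P => //; rewrite expr1; apply/andP; split; first lra.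
  by apply: le_trans (ler_wpM2l a0 vV); lra.
have [x0|/ltW x0] := leP 0 x; first exact: pos.
move=> h; apply/approxN/pos; first by rewrite oppr_ge0.
by rewrite opprK addrC distrC normrN.
Qed.

(** The square root halves the exponent; this is what undoes the error growth of repeated
    squaring. *)
Lemma approx_sqrt c x y :
  0 <= x -> relapprox (c + c) (x ^+ 2) y -> relapprox c x (Num.sqrt y).
Proof.
move=> x0 [t /andP[t1 t2] ->]; have t0 := approx_factor_gt0 t1.
exists (Num.sqrt t); last by rewrite sqrtrM ?sqr_ge0 // sqrtr_sqr ger0_norm.
have vc : v ^+ c = Num.sqrt (v ^+ (c + c)).
  by rewrite exprD -expr2 sqrtr_sqr ger0_norm // ltW.
have vcV : v ^- c = Num.sqrt (v ^- (c + c)) by rewrite sqrtrV ?ltW // -vc.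
by rewrite vcV vc !ler_wsqrtr.
Qed.

Lemma approx_op_add c d x x' y y' : 0 <= x * y ->
  relapprox c x x' -> relapprox d y y' ->
  relapprox (c + d).+1 (x + y) (fl_op F FAdd x' y').
Proof.
move=> xy ax ay; rewrite -addn1; apply: (@approx_trans _ _ _ (x' + y')).
  by apply: approxD => //; [apply: approxW ax | apply: approxW ay];
    rewrite ?leq_addr ?leq_addl.
exact/approx_round/(fl_opP F FAdd).
Qed.

Lemma approx_op_sub0 c x x' : relapprox c x x' ->
  relapprox c.+1 (- x) (fl_op F FSub 0 x').
Proof.
move=> ax; rewrite -addn1; apply: (@approx_trans _ _ _ (- x')).
  exact/approxN.
apply: approx_round; have := fl_opP F FSub 0 x'.
by rewrite /exact_op sub0r.
Qed.

Lemma approx_op_mul c d x x' y y' : relapprox c x x' -> relapprox d y y' ->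
  relapprox (c + d).+1 (x * y) (fl_op F FMul x' y').
Proof.
move=> ax ay; rewrite -addn1; apply: (@approx_trans _ _ _ (x' * y')).
  exact: approxM.
exact/approx_round/(fl_opP F FMul).
Qed.

Lemma approx_op_div c d x x' y y' : relapprox c x x' -> relapprox d y y' ->
  relapprox (c + d).+1 (x / y) (fl_op F FDiv x' y').
Proof.
move=> ax ay; rewrite -addn1; apply: (@approx_trans _ _ _ (x' / y')).
  by apply: approxM => //; apply: approxV.
exact/approx_round/(fl_opP F FDiv).
Qed.

Lemma approx_const (z : int) : relapprox 1 z%:~R (fl_const F z).
Proof. exact/approx_round/fl_constP. Qed.

Lemma approx_fl_sqrt c x y : 0 <= x ->
  relapprox (c + c) (x ^+ 2) y -> relapprox c.+1 x (fl_sqrt F y).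
Proof.
move=> x0 axy; rewrite -addn1; apply: (@approx_trans _ _ _ (Num.sqrt y)).
  exact: approx_sqrt.
apply/approx_round/fl_sqrtP.
by rewrite (approx_ge0 axy) sqr_ge0.
Qed.

(* 1/(1-u) <= 1+2u because u <= 1/2. *)
Lemma approx_hra c x y :
  relapprox c x y -> hra_value (4 ^+ c + 1) (fp_u F) x y.
Proof.
move=> [t /andP[t1 t2] ->]; rewrite /hra_value.
have [->|x0] := eqVneq x 0; first by rewrite mul0r.
(* The factor 4 per rounding: (1 + 2u)(1 + a u) <= 1 + 4 a u as soon as a >= 1 and u <= 1/2. *)
have h : v ^- c <= 1 + 4 ^+ c * fp_u F.
  elim: c {t1 t2} => [|c IH]; first by rewrite !expr0 invr1 mul1r lerDl ltW.
  have vV : v^-1 <= 1 + 2 * fp_u F.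
    rewrite -[leLHS]mul1r ler_pdivrMr //; have := fp_u_le F.
    move: (fp_u F) u_gt0 => u; nra.
  rewrite (exprS v) invfM.
  apply: le_trans (ler_pM _ _ vV IH) _; rewrite ?invr_ge0 //;
    try exact: ltW.
  have : 1 <= 4 ^+ c :> R by rewrite exprn_ege1 // ler1n.
  rewrite exprS; have := fp_u_le F; move: (4 ^+ c) => a.
  have au := u_gt0; move: (fp_u F) au => u u0 u2 a1.
  have w0 : 0 <= u * a by nra.
  have : u * (u * a) <= u * a / 2 by nra.
  have : u * 1 <= u * a by rewrite ler_pM2l.
  nra.
have h' : 1 - 4 ^+ c * fp_u F <= v ^+ c.
  have k0 : 0 <= 4 ^+ c * fp_u F by rewrite mulr_ge0 ?exprn_ge0 // ltW.
  have a1 : v ^+ c <= 1 by rewrite exprn_ile1 // ltW.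
  have := mulfV (lt0r_neq0 (vX_gt0 c)).
  move: h k0 a1 (vX_gt0 c); move: (v ^+ c) => a; move: (a^-1) => b.
  move: (4 ^+ c * _) => k hb k0 a1 a0 ab.
  have := ler_wpM2l (ltW a0) hb; rewrite ab mulrDr.
  have := ler_wpM2r k0 a1; lra.
rewrite -[X in X - _]mulr1 -mulrBr normrM mulrC mulKf ?normr_eq0 //.
(* The summand 1 in the constant makes the inequality strict. *)
rewrite (@le_lt_trans _ _ (4 ^+ c * fp_u F)) //; last first.
  by rewrite mulrDl mul1r ltrDl.
by rewrite ler_norml; apply/andP; split; move: t1 t2 h h'; lra.
Qed.

End Approximation.

(** * Programs with bounded relative error *)

(** Unlike [approx_op_add], this does not add the exponents of the operands. A sum of n terms then
    costs n roundings instead of multiplying the exponent by n, as the doubling law of repeated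
    squaring requires. *)
Lemma approx_op_addn (R : realType) (F : fp_arith R) c (x x' y y' : R) :
  0 <= x -> 0 <= y -> relapprox F c x x' -> relapprox F c y y' ->
  relapprox F c.+1 (x + y) (fl_op F FAdd x' y').
Proof.
move=> x0 y0 ax ay; rewrite -addn1.
apply: (@approx_trans _ _ _ _ _ (x' + y')); first exact: approxD_ge0.
exact/approx_round/(fl_opP F FAdd).
Qed.

Section Computes.
Context (R : realType) (X : Type) (N : nat) (input : X -> store R).
Context (dom : X -> Prop).
Implicit Types (f g h : X -> R) (B c w : nat) (F : fp_arith R) (s : store R).

Definition holds_input x s := forall k, (k < N)%N -> s k = input x k.

Definition same_below B s s' := forall k, (k < B)%N -> s' k = s k.

Lemma same_below_trans B B' s1 s2 s3 : (B <= B')%N ->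
  same_below B s1 s2 -> same_below B' s2 s3 -> same_below B s1 s3.
Proof.
by move=> BB h12 h23 k kB; rewrite h23 ?h12 // (leq_trans kB).
Qed.

Lemma same_below_input B x s s' : (N <= B)%N ->
  holds_input x s -> same_below B s s' -> holds_input x s'.
Proof. by move=> NB hs h k kN; rewrite h ?hs // (leq_trans kN). Qed.

Lemma same_below_set B s w v : (B <= w)%N -> same_below B s (set_reg s w v).
Proof.
move=> Bo k kB; rewrite /set_reg ltn_eqF //; exact: leq_trans Bo.
Qed.

(* Registers below B are protected, so that subprograms can be composed. *)
Definition computes f := forall B, (N <= B)%N -> exists p w c, (B <= w)%N /\
  forall x F s, dom x -> holds_input x s ->
    exists2 s', exec F p s s' & same_below B s s' /\ relapprox F c (f x) (s' w).

Lemma eq_computes f g :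
  (forall x, dom x -> f x = g x) -> computes f -> computes g.
Proof.
move=> fg cf B NB; have [p [w [c [Bo hp]]]] := cf B NB.
exists p, w, c; split => // x F s dx hs; have [s' e [h1 h2]] := hp x F s dx hs.
by exists s' => //; rewrite -fg.
Qed.

Lemma computes_int (z : int) : computes (fun=> z%:~R).
Proof.
move=> B NB; exists (PAssign B (EConst z)), B, 1%N; split=> // x F s _ _.
exists (set_reg s B (fl_const F z)); first exact: exec_assign.
split; first exact: same_below_set.
by rewrite /set_reg eqxx; exact: approx_const.
Qed.

Lemma computes_input k : (k < N)%N -> computes (fun x => input x k).
Proof.
move=> kN B NB; exists (PAssign B (EReg k)), B, 0%N; split=> // x F s _ hs.
exists (set_reg s B (s k)); first exact: exec_assign.
split; first exact: same_below_set.
by rewrite /set_reg eqxx hs //; exact: approx_refl.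
Qed.

(** The second operand is compiled with its working registers above the result of the first, which
    therefore survives its evaluation. *)
Lemma computes_op op f g h :
  (forall x F c d a b, dom x ->
     relapprox F c (f x) a -> relapprox F d (g x) b ->
     relapprox F (c + d).+1 (h x) (fl_op F op a b)) ->
  (forall x, op = FDiv -> dom x -> g x != 0) ->
  computes f -> computes g -> computes h.
Proof.
move=> hop hdiv cf cg B NB; have [p1 [w1 [c1 [Bw1 hp1]]]] := cf B NB.
have NB1 : (N <= w1.+1)%N by rewrite (leq_trans NB) // leqW.
have [p2 [w2 [c2 [Bo2 hp2]]]] := cg _ NB1.
exists (PSeq (PSeq p1 p2) (PAssign w2.+1 (EOp op (EReg w1) (EReg w2)))).
have Bo : (B <= w2.+1)%N by rewrite leqW // (leq_trans _ Bo2) // leqW.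
exists w2.+1, (c1 + c2).+1; split=> // x F s dx hs.
have [s1 e1 [h1 a1]] := hp1 x F s dx hs.
have [s2 e2 [h2 a2]] := hp2 x F s1 dx (same_below_input NB hs h1).
exists (set_reg s2 w2.+1 (fl_op F op (s2 w1) (s2 w2))).
  apply: exec_seq (exec_seq e1 e2) _; apply: exec_assign => /=.
  case: op hop hdiv => // _ hdiv.
  by rewrite (approx_eq0 a2) (negbTE (hdiv _ _ dx)).
split.
  apply: (same_below_trans (leqnn B) h1).
  apply: (same_below_trans (leqnn B) _ (same_below_set _ _ Bo)).
  by move=> k kB; rewrite h2 // (leq_trans kB) // leqW.
rewrite /set_reg eqxx; apply: hop => //.
by rewrite h2.
Qed.

Lemma computesD f g : (forall x, dom x -> 0 <= f x * g x) ->
  computes f -> computes g -> computes (fun x => f x + g x).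
Proof.
move=> fg; apply: (@computes_op FAdd) => // x F c d a b dx.
exact/approx_op_add/fg.
Qed.

Lemma computesM f g :
  computes f -> computes g -> computes (fun x => f x * g x).
Proof.
by apply: (@computes_op FMul) => // x F c d a b dx; exact: approx_op_mul.
Qed.

Lemma computes_div f g : (forall x, dom x -> g x != 0) ->
  computes f -> computes g -> computes (fun x => f x / g x).
Proof.
move=> g0; apply: (@computes_op FDiv) => [x F c d a b dx|x _]; last exact: g0.
exact: approx_op_div.
Qed.

Lemma computesN f : computes f -> computes (fun x => - f x).
Proof.
move=> cf; apply: (@computes_op FSub (fun=> 0) f) cf => //; last first.
  exact: (@computes_int 0).
(* The rounded constant 0 is exactly 0, so the subtraction is a mere change of sign. *)
move=> x F c d a b _ [t _ ->] ab; rewrite mul0r.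
by apply: approxW (approx_op_sub0 ab); rewrite ltnS leq_addl.
Qed.

(** [sg x] witnesses the common sign of the terms. It may vary with the data and is never
    computed. *)
Lemma computes_sum (sg : X -> R) (I : Type) (r : seq I) (P : pred I)
    (f : I -> X -> R) :
  (forall x, dom x -> sg x != 0) ->
  (forall i x, P i -> dom x -> 0 <= sg x * f i x) ->
  (forall i, P i -> computes (f i)) ->
  computes (fun x => \sum_(i <- r | P i) f i x).
Proof.
move=> sg0 f0 cf.
have S0 r' x : dom x -> 0 <= sg x * \sum_(i <- r' | P i) f i x.
  by move=> dx; rewrite mulr_sumr; apply: sumr_ge0 => i Pi; exact: f0.
elim: r => [|i r IH].
  by apply: eq_computes (computes_int 0) => x _; rewrite big_nil.
case Pi : (P i); last first.
  by apply: eq_computes IH => x _; rewrite big_cons Pi.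
apply: (@eq_computes (fun x => f i x + \sum_(i <- r | P i) f i x)).
  by move=> x _; rewrite big_cons Pi.
apply: computesD (cf i Pi) IH => x dx.
have sg2 : 0 < sg x ^+ 2 by rewrite exprn_even_gt0 //= sg0.
rewrite -(pmulr_rge0 _ sg2) expr2 mulrACA; apply: mulr_ge0; first exact: f0.
exact: S0.
Qed.

Lemma computes_sum_ge0 (I : Type) (r : seq I) (P : pred I) (f : I -> X -> R) :
  (forall i x, P i -> dom x -> 0 <= f i x) ->
  (forall i, P i -> computes (f i)) ->
  computes (fun x => \sum_(i <- r | P i) f i x).
Proof.
move=> f0; apply: (@computes_sum (fun=> 1)) => [x _|i x Pi dx].
  exact: oner_neq0.
by rewrite mul1r f0.
Qed.

Lemma computes_prod (I : Type) (r : seq I) (P : pred I) (f : I -> X -> R) :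
  (forall i, P i -> computes (f i)) ->
  computes (fun x => \prod_(i <- r | P i) f i x).
Proof.
move=> cf; elim: r => [|i r IH].
  by apply: eq_computes (computes_int 1) => x _; rewrite big_nil.
case Pi : (P i); last first.
  by apply: eq_computes IH => x _; rewrite big_cons Pi.
apply: eq_computes (computesM (cf i Pi) IH) => x _.
by rewrite big_cons Pi.
Qed.

Lemma computesX f k : computes f -> computes (fun x => f x ^+ k).
Proof.
move=> cf; apply: (@eq_computes (fun x => \prod_(i < k) f x)) => [x _|].
  by rewrite prodr_const card_ord.
exact: computes_prod.
Qed.

Lemma computes_rat (r : rat) : computes (fun=> ratr r).
Proof.
apply: computes_div (computes_int (numq r)) (computes_int (denq r)) => x _.
by rewrite intr_eq0 denq_eq0.
Qed.

(** [B'] lies above all results, so that later code can take its working registers from there on. *)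
Lemma computes_family (J : finType) (f : J -> X -> R) :
  (forall j, computes (f j)) -> forall B, (N <= B)%N ->
  exists p out c B', (forall j, (B <= out j < B')%N) /\ (B <= B')%N /\
    forall x F s, dom x -> holds_input x s ->
      exists2 s', exec F p s s' & same_below B s s' /\
        forall j, relapprox F c (f j x) (s' (out j)).
Proof.
move=> cf B NB.
suff /(_ (enum J)) [p [out [c [B' [h1 [h2 h3]]]]]] : forall js : seq J,
  exists p out c B', (forall j, j \in js -> (B <= out j < B')%N) /\
    (B <= B')%N /\
    forall x F s, dom x -> holds_input x s ->
      exists2 s', exec F p s s' & same_below B s s' /\
        forall j, j \in js -> relapprox F c (f j x) (s' (out j)).
  exists p, out, c, B'; split; first by move=> j; apply: h1; rewrite mem_enum.
  split=> // x F s dx hs; have [s' e [a b]] := h3 x F s dx hs.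
  by exists s' => //; split=> // j; apply: b; rewrite mem_enum.
elim=> [|j js [p [out [c [B' [h1 [BB' h3]]]]]]].
  exists PSkip, (fun=> 0%N), 0%N, B; do ![split=> //] => x F s _ _.
  by exists s; [exact: exec_skip | split].
have [q [w [d [B'w hq]]]] := cf j B' (leq_trans NB BB').
exists (PSeq p q), (fun j' => if j' == j then w else out j'), (c + d)%N, w.+1.
have Bo := leq_trans BB' B'w.
split; [|split; first by rewrite leqW].
  move=> j'; rewrite inE; case: eqP => [_ _|_ /h1 /andP[-> /= h]].
    by rewrite Bo ltnS leqnn.
  by rewrite ltnS ltnW // (leq_trans h).
move=> x F s dx hs; have [s1 e1 [b1 a1]] := h3 x F s dx hs.
have [s2 e2 [b2 a2]] := hq x F s1 dx (same_below_input NB hs b1).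
exists s2; first exact: exec_seq e1 e2.
split; first exact: same_below_trans b1 b2.
move=> j'; rewrite inE; case: eqP => [-> _|_ /= j'js].
  by apply: approxW a2; rewrite leq_addl.
rewrite b2; last by have /andP[] := h1 _ j'js.
by apply: approxW (a1 _ j'js); rewrite leq_addr.
Qed.

End Computes.

Lemma hra_of_computes (R : realType) (X : Type) (J : finType) (N : nat)
    (input : X -> seq R) (dom : X -> Prop) (target : X -> (J -> R) -> Prop)
    (f : J -> X -> R) :
  (forall j, computes N (fun x k => nth 0 (input x) k) dom (f j)) ->
  (forall x, dom x -> target x (fun j => f j x)) ->
  hra_computable input dom target.
Proof.
move=> cf tf; have [p [out [c [B' [_ [_ h]]]]]] := computes_family cf (leqnn N).
exists p, out, (4 ^+ c + 1); split=> [|x dx].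
  by rewrite ltr_wpDl // exprn_ge0.
exists (fun j => f j x) => [|F]; first exact: tf.
have [//|s e [_ a]] := h x F (fun k => nth 0 (input x) k) dx.
by exists s => // j; apply: approx_hra.
Qed.

(** * Matrices in register blocks and their squares *)

Section Blocks.
Context (R : realType) (F : fp_arith R).
Implicit Types (s : store R).

Definition addr (J : finType) (b : nat) (j : J) : nat := (b + enum_rank j)%N.

Lemma addr_inj (J : finType) b : injective (@addr J b).
Proof. by move=> i j /addnI /val_inj /enum_rank_inj. Qed.

Lemma addr_bounds (J : finType) b (j : J) : (b <= addr b j < b + #|J|)%N.
Proof. by rewrite leq_addr ltn_add2l ltn_ord. Qed.

Definition assign_block (J : finType) (b : nat) (es : J -> expr) : program :=
  foldr (fun j p => PSeq (PAssign (addr b j) (es j)) p) PSkip (enum J).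

Definition same_outside b m s s' :=
  forall k, ~~ (b <= k < b + m)%N -> s' k = s k.

(** Assignments run one by one, so an expression is evaluated while part of the block is already
    overwritten; hence the hypothesis ranges over all stores that agree with [s] outside the
    block. *)
Lemma exec_assign_block (J : finType) b (es : J -> expr)
    (P : J -> R -> Prop) s :
  (forall s1, same_outside b #|J| s s1 -> forall j,
     exists2 v, Defs.eval F s1 (es j) = Some v & P j v) ->
  exists2 s', exec F (assign_block b es) s s' &
    same_outside b #|J| s s' /\ forall j, P j (s' (addr b j)).
Proof.
rewrite /assign_block => hes.
suff /(_ (enum J) s) [//|s' e [h1 h2]] : forall (js : seq J) s1,
    same_outside b #|J| s s1 -> exists2 s',
    exec F (foldr (fun j p => PSeq (PAssign (addr b j) (es j)) p) PSkip js)
      s1 s' &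
    (forall k, k \notin map (addr b) js -> s' k = s1 k) /\
    forall j, j \in js -> P j (s' (addr b j)).
  exists s' => //; split=> [k kb|j]; last by apply: h2; rewrite mem_enum.
  rewrite h1 //; apply: contra kb => /mapP[j _ ->]; exact: addr_bounds.
elim=> [|j js IH] s1 hs1; first by exists s1; [exact: exec_skip | split].
have [v ev Pv] := hes s1 hs1 j.
have [k kb|s2 e2 [h1 h2]] := IH (set_reg s1 (addr b j) v).
  rewrite /set_reg; case: eqP => [kj|_]; last exact: hs1.
  by rewrite kj addr_bounds in kb.
exists s2; first by apply: exec_seq e2; apply: exec_assign.
split=> [k|j']; rewrite inE.
  by rewrite negb_or => /andP[kj kjs]; rewrite h1 // /set_reg (negbTE kj).
have [j'js _|j'js] := boolP (j' \in js); first exact: h2.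
rewrite orbF => /eqP jj; rewrite jj in j'js *.
by rewrite h1 ?(mem_map (@addr_inj _ _)) // /set_reg eqxx.
Qed.

Definition sum_expr (es : seq expr) : expr := foldr (EOp FAdd) (EConst 0) es.

Lemma eval_sum_expr (J : Type) (js : seq J) (e : J -> expr) (x : J -> R) c s :
  (forall j, 0 <= x j) ->
  (forall j, exists2 v, Defs.eval F s (e j) = Some v & relapprox F c (x j) v) ->
  exists2 v, Defs.eval F s (sum_expr (map e js)) = Some v &
    relapprox F (c + size js) (\sum_(j <- js) x j) v.
Proof.
move=> x0 he; elim: js => [|j js [v ev av]] /=.
  exists (fl_const F 0) => //; rewrite big_nil addn0.
  have [t _ ->] := approx_const F 0; rewrite mul0r; exact: approx_refl.
have [w ew aw] := he j; rewrite ew ev; exists (fl_op F FAdd w v) => //.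
rewrite big_cons addnS; apply: approx_op_addn => //.
  by rewrite sumr_ge0.
by apply: approxW aw; rewrite leq_addr.
Qed.

Definition holds_mx n c b (A : 'M[R]_n) s :=
  forall i j, relapprox F c (A i j) (s (addr b (i, j))).

Definition square_block n (b b' : nat) : program :=
  assign_block b' (fun ij : 'I_n * 'I_n => sum_expr
    [seq EOp FMul (EReg (addr b (ij.1, l))) (EReg (addr b (l, ij.2)))
       | l <- enum 'I_n]).

Definition mxsq n (A : 'M[R]_n) := A *m A.

(** Each product has exponent 2c + 1 and the sum adds n. The law c -> 2c + n + 1 means that c + n +
    1 exactly doubles with every squaring. *)
Lemma exec_square_block n c b b' (A : 'M[R]_n) s :
  (b + n * n <= b')%N || (b' + n * n <= b)%N ->
  (forall i j, 0 <= A i j) -> holds_mx c b A s ->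
  exists2 s', exec F (square_block n b b') s s' &
    same_outside b' (n * n) s s' /\ holds_mx (c + c + n.+1) b' (mxsq A) s'.
Proof.
move=> bb A0 hA; have cardJ : #|{: 'I_n * 'I_n}| = (n * n)%N.
  by rewrite card_prod card_ord.
have [s1 hs1 [i j]|s' e [h1 h2]] :=
  @exec_assign_block _ b' (fun ij : 'I_n * 'I_n => sum_expr
    [seq EOp FMul (EReg (addr b (ij.1, l))) (EReg (addr b (l, ij.2)))
       | l <- enum 'I_n])
  (fun ij => relapprox F (c + c + n.+1) (mxsq A ij.1 ij.2)) s.
  have hb (k l : 'I_n) : s1 (addr b (k, l)) = s (addr b (k, l)).
    have : (b <= addr b (k, l) < b + #|{: 'I_n * 'I_n}|)%N.
      exact: addr_bounds.
    rewrite cardJ.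
    by move=> hk; apply: hs1; rewrite cardJ; move: bb hk; lia.
  have [||v ev av] := @eval_sum_expr _ (enum 'I_n) (fun l => EOp FMul
      (EReg (addr b (i, l))) (EReg (addr b (l, j))))
      (fun l => A i l * A l j) (c + c).+1 s1.
  - by move=> l; exact: mulr_ge0.
  - move=> l /=.
    exists (fl_op F FMul (s1 (addr b (i, l))) (s1 (addr b (l, j)))) => //.
    by rewrite !hb; apply: approx_op_mul.
  exists v => //=; rewrite /mxsq mxE; move: av.
  by rewrite size_enum_ord addSnnS big_enum.
exists s' => //; split; first by rewrite -cardJ.
by move=> i j; exact: (h2 (i, j)).
Qed.

End Blocks.

(** * Loops whose length is governed by the unit round-off *)

Section UnitLoop.
Context (R : realType) (F : fp_arith R).
Local Notation u := (fp_u F).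

(* With u <= 1/2 the rounded factor 5 enlarges a register at least by 5/4 and
   at most by 16 in each pass, so the number of passes is of the order of
   log(1/u). *)
Definition unit_loop (r : nat) (body : program) : program :=
  PSeq (PAssign r EUnit) (PWhile (EReg r) (EConst 1)
    (PSeq body (PAssign r (EOp FMul (EReg r) (EConst 5))))).

Let x_ k := iter k (fun x => fl_op F FMul x (fl_const F 5)) u.

Let x_gt0 k : 0 < x_ k.
Proof.
have u0 := fp_u_gt0 F.
elim: k => [//|k IH] /=; rewrite (approx_gt0 (approx_op_mul (approx_refl F 0 _)
  (approx_const F 5))) mulr_gt0 //.
Qed.

(** The stored constant 5 lies in [5/2, 15/2] and the product is rounded by a factor in [1/2, 3/2];
    45/4 is enlarged to 16, a power of 2. *)
Let x_bounds k : 5 / 4 * x_ k <= x_ k.+1 <= 16 * x_ k.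
Proof.
have h5 := fl_constP F 5; have hm := fl_opP F FMul (x_ k) (fl_const F 5).
have xk := x_gt0 k; have u0 := fp_u_gt0 F; have u1 := fp_u_le F.
rewrite [x_ k.+1]iterS -/(x_ k).
have e5 : 5%:~R = 5 :> R by [].
rewrite e5 (@gtr0_norm _ 5) // ler_norml in h5; move: h5 => /andP[h1 h2].
have c1 : 5 / 2 <= fl_const F 5 by lra.
have c2 : fl_const F 5 <= 15 / 2 by lra.
have y0 : 0 < x_ k * fl_const F 5 by rewrite mulr_gt0 //; lra.
rewrite /exact_op (gtr0_norm y0) ler_norml in hm; move: hm => /andP[h3 h4].
have y1 : 5 / 2 * x_ k <= x_ k * fl_const F 5 by rewrite mulrC ler_pM2l.
have y2 : x_ k * fl_const F 5 <= 15 / 2 * x_ k.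
  by rewrite [leRHS]mulrC ler_pM2l.
have y3 : u * (x_ k * fl_const F 5) <= 2^-1 * (x_ k * fl_const F 5).
  by rewrite ler_pM2r.
by apply/andP; split; lra.
Qed.

(** [K] depends on the arithmetic only and is the same for every body, so a second loop can undo the
    passes of a first one. The bound on 16^K holds because on exit the register has reached the
    rounded 1, which is at least 1/2. *)
Lemma exec_unit_loop : exists2 K : nat, 2^-1 <= u * 16 ^+ K &
  forall (I : nat -> store R -> Prop) (r : nat) (body : program),
    (forall k s, I k s -> exists2 s', exec F body s s' &
       I k.+1 s' /\ s' r = s r) ->
    (forall k s v, I k s -> I k (set_reg s r v)) ->
    forall s, I 0%N s -> exists2 s', exec F (unit_loop r body) s s' & I K s'.
Proof.
have u0 := fp_u_gt0 F; have u1 := fp_u_le F.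
(* Linear growth suffices for termination. *)
have grow k : u * (1 + k%:R / 4) <= x_ k.
  elim: k => [|k IH]; first by rewrite mul0r addr0 mulr1.
  have /andP[+ _] := x_bounds k; apply: le_trans.
  have : 0 <= u * k%:R by rewrite mulr_ge0 // ltW.
  by rewrite -natr1; move: IH; lra.
have upper k : x_ k <= u * 16 ^+ k.
  elim: k => [|k IH]; first by rewrite expr0 mulr1.
  by have /andP[_] := x_bounds k; rewrite exprS; lra.
have exK : exists k, fl_const F 1 <= x_ k.
  have [k hk] : exists k : nat, 4 * (fl_const F 1 / u) <= k%:R.
    exists (Num.truncn (4 * (fl_const F 1 / u))).+1.
    exact/ltW/truncnS_gt.
  exists k; apply: le_trans (grow k).
  have : u * (4 * (fl_const F 1 / u)) <= u * k%:R by rewrite ler_pM2l.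
  by rewrite mulrCA (mulrCA u) divff ?gt_eqF // mulr1; lra.
exists (ex_minn exK).
  case: ex_minnP => k hk _; apply: le_trans (upper k); apply: le_trans hk.
  have := fl_constP F 1; rewrite normr1 mulr1 ler_norml => /andP[h _].
  by move: h; rewrite (_ : 1%:~R = 1 :> R) //; lra.
case: ex_minnP => K hK Kmin I r body hbody hset s I0.
have loop d k s1 : (d + k = K)%N -> s1 r = x_ k -> I k s1 ->
    exists2 s', exec F (PWhile (EReg r) (EConst 1)
    (PSeq body (PAssign r (EOp FMul (EReg r) (EConst 5))))) s1 s' & I K s'.
  elim: d k s1 => [|d IH] k s1 dk s1r Ik.
    have kK : k = K by rewrite -dk.
    exists s1; last by rewrite -kK.
    by apply: exec_while_false => //=; rewrite s1r kK.
  have [s2 e2 [I2 s2r]] := hbody k s1 Ik.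
  have [||| s3 e3 I3] := IH k.+1 (set_reg s2 r (x_ k.+1)).
  - by rewrite addnS.
  - by rewrite /set_reg eqxx.
  - exact: hset.
  exists s3 => //; apply: exec_while_true e3 => //=.
    rewrite s1r ltNge; apply/negP => /Kmin; rewrite -dk; lia.
  by apply: exec_seq e2 _; apply: exec_assign; rewrite /= s2r s1r.
have [||| s' e' I'] := loop K 0%N (set_reg s r u).
- by rewrite addn0.
- by rewrite /set_reg eqxx.
- exact: hset.
exists s' => //; apply: exec_seq e'; exact: exec_assign.
Qed.

End UnitLoop.

(** * Spectral radius of a nonnegative matrix *)

Section PowerLimit.
Context (R : realType) (X : Type) (N : nat) (input : X -> store R).
Context (dom : X -> Prop).

(** A constant factor C is charged as rounding error: (1 - u)^-K >= (1 + u)^K >= 1 + K u >= 3/2 by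
    Bernoulli, and (3/2)^(2C) >= 1 + C. A root of order K later reduces this charge to 2C
    roundings. *)
Lemma relapprox_of_bounds (F : fp_arith R) (C K : nat) (x y : R) :
  0 < x -> 2^-1 <= fp_u F * K%:R -> x <= y <= C%:R * x ->
  relapprox F (K * (2 * C)) x y.
Proof.
move=> x0 hK /andP[xy yx]; have u0 := fp_u_gt0 F; have u1 := fp_u_le F.
have v0 : 0 < 1 - fp_u F by lra.
apply/approx_ge0P; first exact: ltW.
apply/andP; split.
  by apply: le_trans xy; apply: ler_piMr; rewrite ?exprn_ile1 //; lra.
rewrite -exprVn; apply: le_trans yx _; rewrite mulrC ler_pM2l // exprM.
have vV : 1 + fp_u F <= (1 - fp_u F)^-1.
  rewrite -[leRHS]mul1r ler_pdivlMr //; have := sqr_ge0 (fp_u F); nra.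
have bern (a : R) m : 0 <= a -> 1 + m%:R * a <= (1 + a) ^+ m.
  move=> a0; elim: m => [|m IH]; first by rewrite mul0r addr0.
  rewrite exprS; apply: le_trans (ler_wpM2l _ IH); last lra.
  rewrite -natr1; have : 0 <= m%:R * a * a by rewrite !mulr_ge0.
  lra.
have h : 3 / 2 <= (1 - fp_u F)^-1 ^+ K.
  apply: le_trans (_ : (1 + fp_u F) ^+ K <= _).
    by apply: le_trans (bern _ _ (ltW u0)); rewrite mulrC; lra.
  by apply: lerXn2r => //; rewrite nnegrE ?invr_ge0; lra.
apply: le_trans (_ : (3 / 2) ^+ (2 * C) <= _).
  have : 1 + (2 * C)%:R / 2 <= (1 + 2^-1) ^+ (2 * C) :> R.
    by apply: bern; rewrite invr_ge0.
  by rewrite natrM (_ : 1 + 2^-1 = 3 / 2 :> R); lra.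
by apply: lerXn2r => //; rewrite nnegrE; lra.
Qed.

Lemma fl_sqrt_ge0 (F : fp_arith R) (w : R) : 0 <= w -> 0 <= fl_sqrt F w.
Proof.
by move=> w0; rewrite (approx_ge0 (approx_round (fl_sqrtP F w0))) sqrtr_ge0.
Qed.

(** The summand 2 is the fixed point of c -> c/2 + 1, halving followed by one rounding; the
    roundings of successive roots do not accumulate. *)
Lemma approx_root (F : fp_arith R) e j (f w : R) : 0 <= f ->
  relapprox F (2 ^ j.+1 * e + 2) (f ^+ (2 ^ j.+1)) w ->
  relapprox F (2 ^ j * e + 2) (f ^+ (2 ^ j)) (fl_sqrt F w).
Proof.
move=> f0 h; rewrite [(2 ^ j * e + 2)%N]addnS; apply: approx_fl_sqrt.
  exact: exprn_ge0.
move: h; rewrite -exprM -expnSr; congr (relapprox F _ _ _).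
by rewrite expnS; lia.
Qed.

(* The relative error of A^(2^k) by repeated squaring grows like 2^k, and k
   successive square roots divide it by 2^k again.  Hence the number of
   squarings can grow with the precision, at the expense of no accuracy. *)
Lemma computes_power_limit n (A : X -> 'M[R]_n) (f : X -> R) (C : nat) :
  (forall i j, computes N input dom (fun x => A x i j)) ->
  (forall x i j, dom x -> 0 <= A x i j) ->
  (forall x, dom x -> 0 < f x) ->
  (forall x k, dom x ->
     f x ^+ (2 ^ k) <= \tr (iter k (@mxsq R n) (A x)) <=
       C%:R * f x ^+ (2 ^ k)) ->
  computes N input dom f.
Proof.
move=> cA A0 f0 hf B NB.
have [p [out [c0 [B1 [outB [BB1 hp]]]]]] :=
  @computes_family _ _ N input dom ('I_n * 'I_n)%type
    (fun ij x => A x ij.1 ij.2) (fun ij => cA ij.1 ij.2) B NB.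
pose b1 := B1; pose b2 := (b1 + n * n)%N; pose r := (b2 + n * n)%N.
pose y := r.+1.
pose copy := assign_block b1 (fun ij : 'I_n * 'I_n => EReg (out ij)).
(* Two squarings bring the result back to [b1]. A pass of the loop makes four, since 16 = 2^4: after
   K passes the power is 16^K >= 1/(2u). *)
pose sq2 := PSeq (square_block n b1 b2) (square_block n b2 b1).
pose tr := PAssign y (sum_expr [seq EReg (addr b1 (i, i)) | i <- enum 'I_n]).
pose root := PAssign y (ESqrt (ESqrt (ESqrt (ESqrt (EReg y))))).
exists (PSeq p (PSeq copy (PSeq (unit_loop r (PSeq sq2 sq2))
  (PSeq tr (unit_loop r root))))), y.
pose a := (c0 + n.+1)%N.
(* After all roots, [a] remains of the squarings, [2 * C] of replacing the trace by the power of
   [f], and 2 of the roundings of the roots. *)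
exists (a + 2 * C).+2; split; first by rewrite /y /r /b2 /b1; lia.
move=> x F s dx hs; have [s1 e1 [h1 a1]] := hp x F s dx hs.
pose mats (k : nat) s := same_below B s1 s /\ exists2 c,
  (c + n.+1 = 2 ^ (4 * k) * a)%N &
  holds_mx F c b1 (iter (4 * k) (@mxsq R n) (A x)) s.
have pw0 k i j : 0 <= iter k (@mxsq R n) (A x) i j.
  elim: k i j => [|k IH] i j /=; first exact: A0.
  by rewrite /mxsq mxE sumr_ge0 // => l _; rewrite mulr_ge0.
have cardJ : #|{: 'I_n * 'I_n}| = (n * n)%N by rewrite card_prod card_ord.
have [s2 e2 I2] : exists2 s2, exec F copy s1 s2 & mats 0%N s2.
  have [|s2 e2 [h2 a2]] := @exec_assign_block _ F _ b1
    (fun ij : 'I_n * 'I_n => EReg (out ij))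
    (fun ij => relapprox F c0 (A x ij.1 ij.2)) s1.
    move=> s1' hs1 ij; exists (s1' (out ij)) => //.
    rewrite hs1 //; have := outB ij; rewrite /b1; lia.
  exists s2 => //; split.
    by move=> k kB; apply: h2; rewrite /b1; lia.
  exists c0; first by rewrite muln0 mul1n.
  by move=> i j; exact: (a2 (i, j)).
have step k c s3 : same_below B s1 s3 ->
    holds_mx F c b1 (iter k (@mxsq R n) (A x)) s3 ->
    exists2 s4, exec F sq2 s3 s4 & [/\ same_below B s1 s4, s4 r = s3 r &
      holds_mx F (2 * (2 * c + n.+1) + n.+1) b1
        (iter k.+2 (@mxsq R n) (A x)) s4].
  move=> h3 m3; have [|//||s4 e4 [h4 m4]] := @exec_square_block _ F n c b1 b2
    (iter k (@mxsq R n) (A x)) s3; rewrite ?leqnn //.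
  have [||//|s5 e5 [h5 m5]] := @exec_square_block _ F n (c + c + n.+1) b2 b1
    (iter k.+1 (@mxsq R n) (A x)) s4; rewrite ?leqnn ?orbT //.
  exists s5; first exact: exec_seq e4 e5.
  split; last by rewrite !mul2n -!addnn.
    move=> i iB; rewrite h5 ?h4 ?h3 //; move: iB; rewrite /b2 /b1; lia.
  by rewrite h5 ?h4 // /r /b2; lia.
have [K hK loop] := exec_unit_loop F.
have [|k sa w [h3 [c hc m3]]|s3 e3 [h3 [c hc m3]]] :=
  loop mats r (PSeq sq2 sq2) _ _ s2 I2.
- move=> k s3 [h3 [c hc m3]].
  have [s4 e4 [h4 r4 m4]] := step _ _ _ h3 m3.
  have [s5 e5 [h5 r5 m5]] := step _ _ _ h4 m4.
  exists s5; first exact: exec_seq e4 e5.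
  split; last by rewrite r5.
  split=> //; rewrite mulnS !addSn add0n; eexists; last exact: m5.
  by rewrite !expnS; lia.
- split; first by apply: (same_below_trans (leqnn B) h3);
    apply: same_below_set; rewrite /r /b2 /b1; lia.
  exists c => // i j; rewrite /set_reg ifN //.
  have : (b1 <= addr b1 (i, j) < b1 + #|{: 'I_n * 'I_n}|)%N.
    exact: addr_bounds.
  by rewrite cardJ /r /b2; lia.
pose m := (2 ^ (4 * K))%N.
have [v ev av] : exists2 v, Defs.eval F s3
    (sum_expr [seq EReg (addr b1 (i, i)) | i <- enum 'I_n]) = Some v &
    relapprox F (m * (a + 2 * C) + 2) (f x ^+ m) v.
  have [|i|v ev av] := @eval_sum_expr _ F _ (enum 'I_n)
    (fun i => EReg (addr b1 (i, i)))
    (fun i => iter (4 * K) (@mxsq R n) (A x) i i) c s3.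
  - by move=> i; exact: pw0.
  - by exists (s3 (addr b1 (i, i))).
  exists v => //.
  have htr := hf x (4 * K)%N dx.
  have hu : 2^-1 <= fp_u F * m%:R.
    by rewrite /m expnM natrX.
  have := approx_trans (relapprox_of_bounds (exprn_gt0 _ (f0 x dx)) hu htr).
  rewrite big_enum size_enum_ord in av => /(_ _ _ av); apply: approxW.
  by rewrite -/m in hc; lia.
pose s4 := set_reg s3 y v.
(* The loop lemma asks for preservation at every k; beyond K only nonnegativity is claimed, which
   keeps the square roots defined. *)
pose roots k s := [/\ same_below B s1 s, 0 <= s y & (k <= K)%N ->
  relapprox F (2 ^ (4 * (K - k)) * (a + 2 * C) + 2)
    (f x ^+ (2 ^ (4 * (K - k)))) (s y)].
have I4 : roots 0%N s4.
  split=> [||_].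
  - by apply: (same_below_trans (leqnn B) h3); apply: same_below_set;
      rewrite /y /r /b2 /b1; lia.
  - by rewrite /s4 /set_reg eqxx (approx_ge0 av) exprn_ge0 ?ltW ?f0.
  by rewrite /s4 /set_reg eqxx subn0.
have [|k s' w [h r0 rr]|s5 e5 [h5 _ a5]] := loop roots r root _ _ s4 I4.
- move=> k s' [h r0 rr]; have w0 := fl_sqrt_ge0 F r0.
  have w1 := fl_sqrt_ge0 F w0; have w2 := fl_sqrt_ge0 F w1.
  have w3 := fl_sqrt_ge0 F w2.
  exists (set_reg s' y (fl_sqrt F (fl_sqrt F (fl_sqrt F (fl_sqrt F (s' y)))))).
    apply: exec_assign => /=.
    by rewrite ltNge r0 /= ltNge w0 /= ltNge w1 /= ltNge w2.
  split; last by rewrite /set_reg ltn_eqF.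
  split=> [i iB||kK]; rewrite ?/set_reg ?eqxx //.
    by rewrite ifN ?h //; move: iB; rewrite /y /r /b2 /b1; lia.
  have fx0 := ltW (f0 x dx).
  do 4![apply: approx_root => //].
  move: (rr (ltnW kK)); rewrite -[in X in X -> _](subnSK kK) mulnS.
  by rewrite !addSn add0n.
- split=> [i iB||/rr]; rewrite /set_reg ?[y == _]gtn_eqF //.
  by rewrite ifN ?h //; move: iB; rewrite /r /b2 /b1; lia.
exists s5.
  apply: exec_seq e1 _; apply: exec_seq e2 _; apply: exec_seq e3 _.
  by apply: exec_seq e5; apply: exec_assign.
split; first by apply: same_below_trans h5.
have := a5 (leqnn K); rewrite subnn muln0 expn0 expr1 mul1n.
by apply: approxW; rewrite /a; lia.
Qed.

End PowerLimit.

(** * Minors *)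

Definition increasing (k n : nat) (f : 'I_k -> 'I_n) :=
  {homo f : i j / (i < j)%N}.

(** A boolean predicate on finite functions, so that sums can range over the k-element index
    sets. *)
Definition incr (k n : nat) (h : {ffun 'I_k -> 'I_n}) : bool :=
  [forall i : 'I_k, [forall j : 'I_k, (i < j)%N ==> (h i < h j)%N]].

Lemma incrP k n (h : {ffun 'I_k -> 'I_n}) :
  reflect (increasing h) (incr h).
Proof.
apply: (iffP forallP) => [hh i j ij|hh i].
  by have /forallP/(_ j)/implyP := hh i; apply.
by apply/forallP => j; apply/implyP; exact: hh.
Qed.

Lemma incr_finfun k n (f : 'I_k -> 'I_n) :
  increasing f -> incr (finfun f).
Proof. by move=> hf; apply/incrP => i j ij; rewrite !ffunE hf. Qed.

Lemma homo_ord_inj k n (h : 'I_k -> 'I_n) :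
  increasing h -> injective h.
Proof.
move=> hh i j hij; apply: val_inj; apply/eqP; rewrite eqn_leq.
by apply/andP; split; rewrite leqNgt; apply/negP => /hh; rewrite hij ltnn.
Qed.

Lemma sorted_codom_incr k n (h : {ffun 'I_k -> 'I_n}) :
  incr h -> sorted (fun i j : 'I_n => (i < j)%N) (codom h).
Proof.
move/incrP => hh; rewrite sorted_map.
apply: (@sub_sorted _ (relpre val ltn)) => [i j|]; first exact: hh.
by rewrite -sorted_map val_enum_ord; exact: iota_ltn_sorted.
Qed.

(** Both increasing maps list the same values, and strictly sorted lists with the same elements are
    equal. *)
Lemma incr_perm_inj k n (g g' : {ffun 'I_k -> 'I_n}) (s s' : 'S_k) :
  incr g -> incr g' -> (forall i, g (s i) = g' (s' i)) -> g = g' /\ s = s'.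
Proof.
move=> ig ig' e; suff gg : g = g'.
  split=> //; apply/permP => i.
  apply: (@homo_ord_inj _ _ g'); first exact/incrP.
  by rewrite -[in LHS]gg e.
have mem_eq : codom g =i codom g'.
  move=> y; apply/codomP/codomP => -[i ->].
    by exists (s' (s^-1 i)%g); rewrite -e permKV.
  by exists (s (s'^-1 i)%g); rewrite e permKV.
have ec : codom g = codom g'.
  apply: irr_sorted_eq (sorted_codom_incr ig) (sorted_codom_incr ig') mem_eq.
    by move=> x y z; exact: ltn_trans.
  by move=> x; rewrite ltnn.
by apply/ffunP => i; move/eq_in_map: ec; apply; rewrite mem_enum.
Qed.

(** Sorting the values of [h] gives [g]; the sorting permutation gives [s]. *)
Lemma inj_incr_perm k n (h : {ffun 'I_k -> 'I_n}) : injective h ->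
  exists g : {ffun 'I_k -> 'I_n}, exists s : 'S_k,
    incr g /\ h = [ffun i => g (s i)].
Proof.
move=> ih; pose le := fun i j : 'I_n => (i <= j)%N.
pose t := [tuple of sort le [tuple h i | i < k]].
have /tuple_permP[s es] : perm_eq [tuple h i | i < k] t.
  by rewrite perm_sym perm_sort.
exists [ffun i => tnth t i], s; split; last first.
  apply/ffunP => i; rewrite !ffunE.
  have := congr1 (fun u => nth (h i) u i) es.
  by rewrite -!tnth_nth !tnth_mktuple.
apply: incr_finfun => i j ij; rewrite !(tnth_nth (h i)).
have st : sorted (fun i j : 'I_n => (i < j)%N) t.
  rewrite (@eq_sorted _ _ (relpre val ltn)) // -sorted_map ltn_sorted_uniq_leq.
  rewrite map_inj_uniq; last exact: val_inj.
  rewrite sort_uniq map_inj_uniq // enum_uniq /=.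
  rewrite sorted_map; apply: sort_sorted => x y; exact: leq_total.
have tr : transitive (fun i j : 'I_n => (i < j)%N).
  by move=> x y z; exact: ltn_trans.
have /(_ i j) := sorted_ltn_nth tr (h i) st.
by rewrite !inE size_tuple !ltn_ord; apply.
Qed.

(** Multilinearity in the rows gives a sum over all maps h. A noninjective h repeats a row of B and
    contributes 0; an injective one is uniquely an increasing map after a permutation, and the sum
    over permutations rebuilds the minor of A. *)
Lemma Cauchy_Binet (R : comNzRingType) k n (A : 'M[R]_(k, n))
    (B : 'M[R]_(n, k)) :
  \det (A *m B) =
  \sum_(h : {ffun 'I_k -> 'I_n} | incr h)
     \det (colsub h A) * \det (rowsub h B).
Proof.
transitivity (\sum_(h : {ffun 'I_k -> 'I_n})
    (\prod_i A i (h i)) * \det (rowsub h B)).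
  rewrite /determinant; under eq_bigr => s _.
    under eq_bigr => i _ do rewrite mxE.
    rewrite bigA_distr_bigA /= mulr_sumr; over.
  rewrite exchange_big; apply: eq_bigr => h _ /=; rewrite mulr_sumr.
  apply: eq_bigr => s _; rewrite big_split mulrCA; do 2!congr (_ * _).
  by apply: eq_bigr => i _; rewrite mxE.
rewrite (bigID (fun h : {ffun 'I_k -> 'I_n} => injectiveb h)) /=.
rewrite [X in _ + X]big1 ?addr0; last first.
  move=> h /injectivePn[i [j ij hij]].
  rewrite (determinant_alternate ij) ?mulr0 // => l.
  by rewrite !mxE hij.
pose P := [set gs : {ffun 'I_k -> 'I_n} * 'S_k | incr gs.1]%SET.
pose comp (gs : {ffun 'I_k -> 'I_n} * 'S_k) := [ffun i => gs.1 (gs.2 i)].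
have -> : \sum_(h : {ffun 'I_k -> 'I_n} | injectiveb h)
    (\prod_i A i (h i)) * \det (rowsub h B) =
  \sum_(h in (comp @: P)%SET) (\prod_i A i (h i)) * \det (rowsub h B).
  apply: eq_bigl => h; apply/injectiveP/imsetP => [/inj_incr_perm|].
    by move=> [g [s [ig ->]]]; exists (g, s); rewrite ?inE.
  move=> [[g s]]; rewrite inE => /incrP /homo_ord_inj ig -> i j.
  by rewrite !ffunE => /ig /perm_inj.
rewrite big_imset; last first.
  move=> [g s] [g' s']; rewrite !inE => ig ig' /ffunP e.
  have [i|/= -> -> //] := incr_perm_inj ig ig' (s := s) (s' := s').
  by have := e i; rewrite !ffunE.
rewrite (eq_bigl (fun gs : {ffun 'I_k -> 'I_n} * 'S_k => incr gs.1 && true));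
  last by move=> gs; rewrite inE andbT.
rewrite -(pair_big (fun g => incr g) xpredT (fun g s =>
   (\prod_i A i (comp (g, s) i)) * \det (rowsub (comp (g, s)) B))) /=.
apply: eq_bigr => g _; rewrite /determinant mulr_suml; apply: eq_bigr => s _.
rewrite -[in LHS]/(\det (rowsub (comp (g, s)) B)).
have -> : rowsub (comp (g, s)) B = row_perm s (rowsub g B).
  by apply/matrixP => i j; rewrite !mxE ffunE.
rewrite row_permE det_mulmx det_perm mulrCA mulrA; congr (_ * _ * _).
by apply: eq_bigr => i _; rewrite ffunE mxE.
Qed.

Lemma det_mxsub_mulmx (R : comNzRingType) k m n p (A : 'M[R]_(m, n))
    (B : 'M[R]_(n, p)) (f : 'I_k -> 'I_m) (g : 'I_k -> 'I_p) :
  \det (mxsub f g (A *m B)) =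
  \sum_(h : {ffun 'I_k -> 'I_n} | incr h)
     \det (mxsub f h A) * \det (mxsub h g B).
Proof.
have -> : mxsub f g (A *m B) = rowsub f A *m colsub g B.
  by apply/matrixP => i j; rewrite !mxE; apply: eq_bigr => l _; rewrite !mxE.
rewrite Cauchy_Binet; apply: eq_bigr => h _.
have -> : colsub h (rowsub f A) = mxsub f h A.
  by apply/matrixP => i j; rewrite !mxE.
have -> : rowsub h (colsub g B) = mxsub h g B.
  by apply/matrixP => i j; rewrite !mxE.
by [].
Qed.

(* In a minor of a bidiagonal matrix with increasing indices, either the first
   row or the first column has at most one nonzero entry, in the corner. *)
Lemma det_mxsub_bidiag (R : comNzRingType) n (B : 'M[R]_n)
    k (f g : 'I_k -> 'I_n) :
  (forall i j : 'I_n, j != i -> j.+1 != i :> nat -> B i j = 0) ->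
  increasing f -> increasing g ->
  \det (mxsub f g B) = \prod_i B (f i) (g i).
Proof.
move=> hB; elim: k f g => [|k IH] f g hf hg; first by rewrite det_mx00 big_ord0.
have f0 i : (f ord0 < f (lift ord0 i))%N by apply: hf.
have g0 i : (g ord0 < g (lift ord0 i))%N by apply: hg.
have IH0 : \det (row' ord0 (col' ord0 (mxsub f g B))) =
    \prod_(i < k) B (f (lift ord0 i)) (g (lift ord0 i)).
  rewrite -IH; first by congr (\det _); apply/matrixP => i j; rewrite !mxE.
    by move=> i j ij; apply: hf; rewrite !lift0.
  by move=> i j ij; apply: hg; rewrite !lift0.
have [fg|fg] := leqP (f ord0) (g ord0).
  rewrite (expand_det_row _ ord0) big_ord_recl big1 ?addr0.
    by rewrite big_ord_recl /cofactor expr0 mul1r IH0 mxE.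
  move=> i _; rewrite mxE hB ?mul0r //.
    by apply/eqP => e; have := g0 i; rewrite e ltnNge fg.
  by apply/eqP => e; have := g0 i; rewrite ltnNge (leq_trans _ fg) // -e.
rewrite (expand_det_col _ ord0) big_ord_recl big1 ?addr0.
  by rewrite big_ord_recl /cofactor expr0 mul1r IH0 mxE.
move=> i _; rewrite mxE hB ?mul0r //.
  by apply/eqP => e; have := f0 i; rewrite -e ltnNge ltnW.
by apply/eqP => e; have := f0 i; rewrite -e ltnS leqNgt fg.
Qed.

Lemma det_mxsub_diag (R : comNzRingType) n (d : 'rV[R]_n)
    k (f g : 'I_k -> 'I_n) :
  increasing f -> increasing g ->
  \det (mxsub f g (diag_mx d)) = \prod_i diag_mx d (f i) (g i).
Proof.
apply: det_mxsub_bidiag => i j ij _; rewrite mxE [i == j]eq_sym.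
by rewrite (negbTE ij).
Qed.

(** * The Gramian matrix *)

Lemma Rintegral_deriv01 (R : realType) (Q : {poly R}) :
  \int[@lebesgue_measure R]_(x in `[0, 1]) Q^`().[x] = Q.[1] - Q.[0].
Proof.
rewrite /Rintegral (@continuous_FTC2 _ _ (horner Q)) //.
- by apply/continuous_subspaceT => x; exact: continuous_horner.
- split=> [x _||]; first exact: derivable_horner.
  + by apply: cvg_at_right_filter; exact: continuous_horner.
  + by apply: cvg_at_left_filter; exact: continuous_horner.
- by move=> x _; rewrite derivE.
Qed.

Lemma Rintegral_polyM01 (R : realType) n (p r : {poly R}) :
  (size p <= n)%N -> (size r <= n)%N ->
  \int[@lebesgue_measure R]_(x in `[0, 1]) (p.[x] * r.[x]) =
  \sum_(a < n) \sum_(b < n) p`_a * r`_b / (a + b).+1%:R.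
Proof.
move=> sp sr; pose Q : {poly R} := \sum_(a < n) \sum_(b < n)
  (p`_a * r`_b / (a + b).+1%:R) *: 'X^((a + b).+1).
have horner_coefn (s : {poly R}) x : (size s <= n)%N ->
    s.[x] = \sum_(a < n) s`_a * x ^+ a.
  exact: horner_coef_wide.
have QE x : p.[x] * r.[x] = Q^`().[x].
  rewrite (horner_coefn p) // (horner_coefn r) // big_distrlr /=.
  rewrite !raddf_sum horner_sum.
  apply: eq_bigr => a _; rewrite raddf_sum horner_sum; apply: eq_bigr => b _.
  rewrite /= derivZ derivXn /= hornerZ hornerMn hornerXn mulrnAr -mulrnAl.
  rewrite -[X in _ = X * _]mulr_natr.
  by rewrite divfK ?pnatr_eq0 // exprD mulrACA.
under eq_Rintegral do rewrite QE.
rewrite Rintegral_deriv01 !horner_sum -sumrB; apply: eq_bigr => a _.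
rewrite !horner_sum -sumrB; apply: eq_bigr => b _.
by rewrite !hornerZ !hornerXn expr1n expr0n mulr0 subr0 mulr1.
Qed.

(** * Positivity of Cauchy determinants *)

Lemma det_schur (F : fieldType) k (A : 'M[F]_k.+1) : A ord0 ord0 != 0 ->
  \det A = A ord0 ord0 * \det (\matrix_(i < k, j < k)
    (A (lift ord0 i) (lift ord0 j) -
     A (lift ord0 i) ord0 / A ord0 ord0 * A ord0 (lift ord0 j))).
Proof.
move=> A0; pose E : 'M[F]_k.+1 := \matrix_(i, j) (if i == j then 1 else
  if j == ord0 then - (A i ord0 / A ord0 ord0) else 0).
have detE : \det E = 1.
  rewrite det_trig ?big1 // => [i _|]; first by rewrite mxE eqxx.
  apply/is_trig_mxP => i j ij; rewrite mxE -val_eqE /= ltn_eqF //.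
  by rewrite ifN // -val_eqE /= -lt0n (leq_ltn_trans _ ij).
have EA0 j : (E *m A) ord0 j = A ord0 j.
  rewrite mxE big_ord_recl !mxE eqxx mul1r big1 ?addr0 // => i _.
  by rewrite mxE /= mul0r.
have EAS i j : (E *m A) (lift ord0 i) j =
    A (lift ord0 i) j - A (lift ord0 i) ord0 / A ord0 ord0 * A ord0 j.
  rewrite mxE (bigD1 (lift ord0 i)) //= mxE eqxx mul1r; congr (_ + _).
  rewrite (bigD1 ord0) //= mxE /= mulNr big1 ?addr0 // => l /andP[li l0].
  by rewrite mxE eq_sym (negbTE li) (negbTE l0) mul0r.
rewrite -[LHS]mul1r -detE -det_mulmx (expand_det_col _ ord0) big_ord_recl.
rewrite big1 ?addr0 => [|i _]; last first.
  by rewrite EAS divfK // subrr mul0r.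
rewrite EA0 /cofactor expr0 mul1r; congr (_ * \det _).
by apply/matrixP => i j; rewrite mxE mxE EAS mxE.
Qed.

(** The Schur complement of a Cauchy matrix is the Cauchy matrix of the remaining nodes between two
    positive diagonal matrices, so induction avoids the closed formula. *)
Lemma det_cauchy_gt0 (F : realFieldType) k (x y : 'I_k -> F) :
  {homo x : i j / (i < j)%N >-> i < j} ->
  {homo y : i j / (i < j)%N >-> i < j} ->
  (forall i j, 0 < x i + y j) -> 0 < \det (\matrix_(i, j) (x i + y j)^-1).
Proof.
elim: k x y => [|k IH] x y hx hy xy; first by rewrite det_mx00.
rewrite det_schur ?mxE; last by rewrite invr_neq0 // gt_eqF.
rewrite mulr_gt0 ?invr_gt0 //.
pose s := lift (@ord0 k).
have xs i : 0 < x (s i) - x ord0 by rewrite subr_gt0 hx.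
have ys i : 0 < y (s i) - y ord0 by rewrite subr_gt0 hy.
pose dx := \row_i ((x (s i) - x ord0) / (x (s i) + y ord0)).
pose dy := \row_j ((y (s j) - y ord0) / (x ord0 + y (s j))).
rewrite (_ : \matrix_(_, _) _ = diag_mx dx *m
    (\matrix_(i, j) (x (s i) + y (s j))^-1) *m diag_mx dy); last first.
  apply/matrixP => i j; rewrite mul_diag_mx mul_mx_diag !mxE -/(s i) -/(s j).
  have h1 := lt0r_neq0 (xy (s i) (s j)); have h2 := lt0r_neq0 (xy (s i) ord0).
  have h3 := lt0r_neq0 (xy ord0 (s j)); have h4 := lt0r_neq0 (xy ord0 ord0).
  by field; rewrite h1 h2 h3 h4.
rewrite !det_mulmx !det_diag !mulr_gt0 //.
- by apply: prodr_gt0 => i _; rewrite mxE divr_gt0.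
- apply: IH => [i j ij|i j ij|//]; first by apply: hx; rewrite /s !lift0.
  by apply: hy; rewrite /s !lift0.
- by apply: prodr_gt0 => i _; rewrite mxE divr_gt0.
Qed.

(** * Coefficients of the q-Abel polynomials *)

Section QAbelCoef.
Context (R : realType) (q : R).
Local Notation "[[ m ]]" := (qint q m).

Lemma qint0 : [[0]] = 0. Proof. by rewrite /qint big_ord0. Qed.

Lemma qint_add a b : [[a + b]] = [[a]] + q ^+ a * [[b]].
Proof.
rewrite /qint big_split_ord /= mulr_sumr; congr (_ + _).
by apply: eq_bigr => i _; rewrite exprD.
Qed.

Lemma qintS m : [[m.+1]] = 1 + q * [[m]].
Proof. by rewrite -add1n qint_add {1}/qint big_ord1 expr0 expr1. Qed.

Lemma qint_gt0 m : 0 < q -> (0 < m)%N -> 0 < [[m]].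
Proof.
move=> q0; case: m => // m _; rewrite qintS ltr_pwDl //.
apply: mulr_ge0; first exact: ltW.
by apply: sumr_ge0 => i _; rewrite exprn_ge0 // ltW.
Qed.

(** The q-binomial theorem cleared of the denominator [l]!: since [k+1] - [r+1] = q^(r+1) [k-r] for
    r <= k, the product on the right holds both the power of q and the falling q-factorial. For l >
    k one of its factors vanishes. *)
Lemma qbinomial_coef (b : R) k l :
  (\prod_(1 <= j < k.+1) (q ^+ j *: 'X + b%:P))`_l *
    \prod_(r < l) [[r.+1]] =
  b ^+ (k - l) * \prod_(r < l) ([[k.+1]] - [[r.+1]]).
Proof.
elim: k l => [|k IH] l.
  rewrite big_geq // coef1; case: l => [|l]; first by rewrite !big_ord0 !mulr1.
  by rewrite mul0r big_ord_recl subrr mul0r mulr0.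
rewrite big_nat_recr //=; set P := \prod_(_ <= _ < _) _.
have PE : P * (q ^+ k.+1 *: 'X + b%:P) = q ^+ k.+1 *: (P * 'X) + b *: P.
  by rewrite mulrDr -scalerAr mulrC [P * _]mulrC mul_polyC [_ * P]mulrC.
rewrite PE coefD !coefZ coefMX; case: l => [|l] /=.
  have := IH 0%N; rewrite !big_ord0 !mulr1 -/P !subn0 => ->.
  by rewrite mulr0 add0r exprS.
have shift : \prod_(r < l.+1) ([[k.+2]] - [[r.+1]]) =
    q ^+ l.+1 * ([[k.+1]] * \prod_(r < l) ([[k.+1]] - [[r.+1]])).
  transitivity (\prod_(r < l.+1) (q * ([[k.+1]] - [[r]]))).
    by apply: eq_bigr => r _; rewrite (qintS k.+1) (qintS r); ring.
  rewrite big_split /= prodr_const card_ord big_ord_recl qint0 subr0.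
  by [].
(* The q-Pascal rule, from the two ways of splitting [k+l+2]. *)
have key : q ^+ k.+1 * [[l.+1]] + ([[k.+1]] - [[l.+1]]) = q ^+ l.+1 * [[k.+1]].
  have h : [[l.+1]] + q ^+ l.+1 * [[k.+1]] = [[k.+1]] + q ^+ k.+1 * [[l.+1]].
    by rewrite -!qint_add addnC.
  by rewrite addrA [X in X - _]addrC -h; ring.
rewrite shift subSS mulrDl -mulrA -(mulrA b) (IH l.+1) !big_ord_recr /=.
(* For l >= k the truncated exponents do not match, but the factor with index k is 0. *)
have -> : b * (b ^+ (k - l.+1) * (\prod_(i < l) ([[k.+1]] - [[i.+1]]) *
    ([[k.+1]] - [[l.+1]]))) = b ^+ (k - l) *
    (\prod_(i < l) ([[k.+1]] - [[i.+1]]) * ([[k.+1]] - [[l.+1]])).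
  have [lk|kl] := ltnP l k; first by rewrite mulrA -exprS subnSK.
  suff -> : \prod_(i < l) ([[k.+1]] - [[i.+1]]) * ([[k.+1]] - [[l.+1]]) = 0.
    by rewrite !mulr0.
  rewrite -(big_ord_recr _ (fun i => [[k.+1]] - [[i.+1]])).
  by rewrite (bigD1 (Ordinal (kl : k < l.+1)%N)) //= subrr mul0r.
rewrite (mulrA P`_l) (IH l) mulrA [q ^+ l.+1 * _]mulrA -key; ring.
Qed.

(* A_m = sum_l b^(m-l) [m]^(m-1) prod_(1 <= r < l) (1/[r] - 1/[m]) x^l with
   b = - alpha: after scaling, Newton polynomials at the nodes -1/[r]. *)
Lemma qAbel_coef alpha m l : 0 < q ->
  (qAbel q alpha m.+1)`_l.+1 =
  (- alpha) ^+ (m - l) * [[m.+1]] ^+ m *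
    \prod_(r < l) ([[r.+1]]^-1 - [[m.+1]]^-1).
Proof.
move=> q0; have y0 k : [[k.+1]] != 0 by rewrite gt_eqF // qint_gt0.
rewrite /qAbel coefXM /=; set c := - alpha * [[m.+1]].
have -> : \prod_(1 <= j < m.+1) (q ^+ j *: 'X - (alpha * [[m.+1]])%:P) =
    \prod_(1 <= j < m.+1) (q ^+ j *: 'X + c%:P) :> {poly R}.
  by apply: eq_bigr => j _; rewrite /c mulNr polyCN.
have P0 : \prod_(r < l) [[r.+1]] != 0 by apply/prodf_neq0 => r _.
apply: (mulIf P0); rewrite qbinomial_coef /c exprMn -!mulrA; congr (_ * _).
have -> : \prod_(r < l) ([[m.+1]] - [[r.+1]]) = [[m.+1]] ^+ l *
    (\prod_(r < l) ([[r.+1]]^-1 - [[m.+1]]^-1) * \prod_(r < l) [[r.+1]]).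
  rewrite -big_split /= -[in X in X * _](card_ord l) -prodr_const -big_split /=.
  apply: eq_bigr => r _; field; by rewrite !y0.
have [lm|ml] := leqP l m; first by rewrite mulrA -exprD subnK.
by rewrite (bigD1 (Ordinal ml)) //= subrr !mul0r !mulr0.
Qed.

Lemma qAbel_coef00 alpha : (qAbel q alpha 0)`_0 = 1.
Proof. by rewrite /= coef1. Qed.

Lemma qAbel_coef0S alpha l : (qAbel q alpha 0)`_l.+1 = 0.
Proof. by rewrite /= coef1. Qed.

Lemma size_qAbel alpha m : 0 < q -> (size (qAbel q alpha m) <= m.+1)%N.
Proof.
move=> q0; apply/leq_sizeP => -[//|l] ml; case: m ml => [|m] ml.
  exact: qAbel_coef0S.
rewrite qAbel_coef // (bigD1 (Ordinal (ml : m < l)%N)) //=.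
by rewrite subrr mul0r mulr0.
Qed.
End QAbelCoef.

(** * Newton matrices as products of bidiagonal matrices *)

Section BidiagonalProducts.
Context (R : comNzRingType) (n : nat).
Implicit Types (d e v : nat -> R) (A : 'M[R]_n.+1).

Definition lower_bidiag d e : 'M[R]_n.+1 :=
  \matrix_(r, c) (if r == c then d r else if c.+1 == r then e r else 0).

Lemma lower_bidiag_mulmx d e A (r c : 'I_n.+1) :
  (lower_bidiag d e *m A) r c =
  d r * A r c + (if r == 0 :> nat then 0 else e r * A (inord r.-1) c).
Proof.
rewrite mxE (bigD1 r) //= mxE eqxx; congr (_ + _).
case: eqP => [r0|/eqP r0].
  rewrite big1 // => i ir; rewrite mxE eq_sym (negbTE ir) r0 /= mul0r //.
have vr : (inord r.-1 : 'I_n.+1) = r.-1 :> nat.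
  by rewrite inordK // (leq_ltn_trans (leq_pred r)).
have pr : (inord r.-1 : 'I_n.+1) != r by rewrite -val_eqE /= vr; lia.
rewrite (bigD1 (inord r.-1)) //= mxE eq_sym (negbTE pr) vr prednK ?lt0n //.
rewrite eqxx big1 ?addr0 // => i /andP[ir ip].
rewrite mxE eq_sym (negbTE ir) ifN ?mul0r //.
by apply: contra ip => /eqP e1; rewrite -val_eqE /= vr -e1.
Qed.

Lemma det_mxsub_lower_bidiag d e k (f g : 'I_k -> 'I_n.+1) :
  increasing f -> increasing g ->
  \det (mxsub f g (lower_bidiag d e)) = \prod_i lower_bidiag d e (f i) (g i).
Proof.
apply: det_mxsub_bidiag => i j ij ij'.
by rewrite mxE eq_sym (negbTE ij) (negbTE ij').
Qed.

(* newton_dd v i r c is the divided difference of prod_(s < c) (w - v s) at the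
   nodes v i, ..., v r. *)
Fixpoint newton_dd v (i r c : nat) : R :=
  if c is c'.+1 then
    (v r - v c') * newton_dd v i r c' +
    (if r is r'.+1 then newton_dd v i r' c' else 0)
  else (r == i)%:R.

Lemma newton_dd_lt v i r c : (r < i)%N -> newton_dd v i r c = 0.
Proof.
elim: c r => [|c IH] r ri /=; first by rewrite ltn_eqF.
rewrite IH // mulr0 add0r; case: r ri => // r ri; apply: IH; exact: ltnW.
Qed.

Lemma newton_dd_diag v i c : newton_dd v i i c = \prod_(s < c) (v i - v s).
Proof.
elim: c => [|c IH] /=; first by rewrite eqxx big_ord0.
rewrite IH big_ord_recr /= mulrC; case: i {IH} => [|i]; first by rewrite addr0.
by rewrite newton_dd_lt // addr0.
Qed.

(** The nodes v i, ..., v r are all roots of the product. *)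
Lemma newton_dd_gt v i r c : (r < c)%N -> newton_dd v i r c = 0.
Proof.
elim: c r => [//|c IH] r rc /=; have [rc'|cr] := ltnP r c.
  rewrite IH // mulr0 add0r; case: r rc rc' => // r _ rc; apply: IH.
  exact: ltnW.
have -> : r = c by apply/eqP; rewrite eqn_leq -ltnS rc.
by rewrite subrr mul0r add0r; case: c IH {rc cr} => // c IH; rewrite IH.
Qed.

Lemma newton_dd0 v r c : newton_dd v 0 r c = (r == c)%:R.
Proof.
elim: c r => [//|c IH] r /=; case: r => [|r].
  rewrite IH addr0; case: c {IH} => [|c]; first by rewrite subrr mul0r.
  by rewrite mulr0.
rewrite !IH eqSS; case: (eqVneq r.+1 c) => [<-|_].
  by rewrite subrr mul0r add0r.
by rewrite mulr0 add0r.
Qed.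

(** The definition follows the Leibniz rule for a factor w - v c'. This is the usual recursion of
    divided differences in the nodes, solved for the term with fewer nodes so that only v r - v i is
    a difference. *)
Lemma newton_ddS v i r c :
  newton_dd v i.+1 r c = (v r - v i) * newton_dd v i r c +
    (if r is r'.+1 then newton_dd v i r' c else 0).
Proof.
elim: c r => [|c IH] r /=.
  case: r => [|r] /=.
    by rewrite addr0; case: i => [|i]; rewrite ?subrr ?mul0r ?mulr0.
  rewrite eqSS; case: (eqVneq r.+1 i) => [<-|_].
    by rewrite subrr mul0r add0r.
  by rewrite mulr0 add0r.
rewrite IH; case: r => [|r] /=; first by rewrite !addr0 mulrCA.
by rewrite IH; case: r => [|r]; ring.
Qed.

(** Row r'+1 uses the nodes from v (min i r') to v r'. For i = 0 this is the identity; for large i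
    each row has a single node and holds values of Newton polynomials. The powers of b are those of
    the q-Abel coefficients, and row and column 0 stand for the constant A_0. *)
Definition newton_mx v (b : R) (i : nat) : 'M[R]_n.+1 :=
  \matrix_(r, c) match val r, val c with
    | 0%N, 0%N => 1
    | r'.+1, c'.+1 => b ^+ (r' - c') * newton_dd v (minn i r') r' c'
    | _, _ => 0
    end.

Definition newton_step v (b : R) (i : nat) : 'M[R]_n.+1 :=
  lower_bidiag (fun r => if (r <= i.+1)%N then 1 else v r.-1 - v i)
               (fun r => if (r <= i.+1)%N then 0 else b).

Lemma newton_mx0 v b : newton_mx v b 0 = 1%:M.
Proof.
apply/matrixP => -[[|r] hr] [[|c] hc]; rewrite !mxE //= -val_eqE /=.
rewrite min0n newton_dd0 eqSS; case: eqP => [->|_]; last by rewrite mulr0.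
by rewrite subnn mulr1.
Qed.

(** The recursion [newton_ddS] row by row; rows up to i+1 have already reached a single node and
    stay. *)
Lemma newton_mxS v b i :
  newton_mx v b i.+1 = newton_step v b i *m newton_mx v b i.
Proof.
apply/matrixP => r c; rewrite lower_bidiag_mulmx [in LHS]mxE.
case: r => [[|r] hr] /=.
  by rewrite mul1r addr0 mxE.
have vr : (inord r : 'I_n.+1) = r :> nat by rewrite inordK // ltnW.
rewrite ltnS; case: leqP => [ri|ir].
  by rewrite mul1r mul0r addr0 mxE /= !(minn_idPr _) // ltnW.
rewrite !mxE /= vr; case: c => [[|c] hc] /=.
  rewrite mulr0 add0r; case: r ir {hr vr} => // r ir.
  by rewrite mulr0.
rewrite (minn_idPl ir) (minn_idPl (ltnW ir)) newton_ddS mulrDr mulrCA.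
congr (_ + _); case: r ir {hr vr} => // r ir.
rewrite ltnS in ir; rewrite (minn_idPl ir) mulrA -exprS.
have [cr|rc] := leqP c r; first by rewrite subSn.
by rewrite newton_dd_gt // !mulr0.
Qed.

End BidiagonalProducts.

(** * Subtraction-free minors of the Gramian *)

Section ComputableMinors.
Context (R : realType) (X : Type) (N : nat) (input : X -> store R).
Context (dom : X -> Prop).
Local Notation computes := (computes N input dom).

(** Nonnegativity belongs to the notion: it keeps the Cauchy-Binet sums free of cancellation, which
    makes the notion stable under products. *)
Definition minors_computable n (A : X -> 'M[R]_n) :=
  forall k (f g : 'I_k -> 'I_n), increasing f -> increasing g ->
    computes (fun x => \det (mxsub f g (A x))) /\
    (forall x, dom x -> 0 <= \det (mxsub f g (A x))).

Lemma eq_minors_computable n (A B : X -> 'M[R]_n) :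
  (forall x, dom x -> A x = B x) ->
  minors_computable A -> minors_computable B.
Proof.
move=> AB mA k f g hf hg; have [cA A0] := mA k f g hf hg.
split; first by apply: eq_computes cA => x dx; rewrite AB.
by move=> x dx; rewrite -AB // A0.
Qed.

Lemma minors_computable_mul n (A B : X -> 'M[R]_n) :
  minors_computable A -> minors_computable B ->
  minors_computable (fun x => A x *m B x).
Proof.
move=> mA mB k f g hf hg; split; last first.
  move=> x dx; rewrite det_mxsub_mulmx; apply: sumr_ge0 => h /incrP ih.
  by apply: mulr_ge0; [exact: (mA k f h hf ih).2 | exact: (mB k h g ih hg).2].
apply: (@eq_computes _ _ _ _ _ (fun x => \sum_(h : {ffun 'I_k -> 'I_n} | incr h)
     \det (mxsub f h (A x)) * \det (mxsub h g (B x)))).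
  by move=> x _; rewrite det_mxsub_mulmx.
apply: computes_sum_ge0 => [h x /incrP ih dx|h /incrP ih].
  by apply: mulr_ge0; [exact: (mA k f h hf ih).2 | exact: (mB k h g ih hg).2].
by apply: computesM; [exact: (mA k f h hf ih).1 | exact: (mB k h g ih hg).1].
Qed.

Lemma minors_computable_tr n (A : X -> 'M[R]_n) :
  minors_computable A -> minors_computable (fun x => (A x)^T).
Proof.
move=> mA k f g hf hg; have [cA A0] := mA k g f hg hf.
have tr x : \det (mxsub f g (A x)^T) = \det (mxsub g f (A x)).
  by rewrite -[LHS]det_tr; congr (\det _); apply/matrixP => i j; rewrite !mxE.
split=> [|x dx]; last by rewrite tr A0.
by apply: eq_computes cA => x _; rewrite tr.
Qed.

Lemma minors_computable_lower_bidiag n (d e : X -> nat -> R) :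
  (forall r, computes (fun x => d x r)) ->
  (forall r, computes (fun x => e x r)) ->
  (forall r x, dom x -> 0 <= d x r) -> (forall r x, dom x -> 0 <= e x r) ->
  minors_computable (fun x => lower_bidiag n (d x) (e x)).
Proof.
move=> cd ce d0 e0 k f g hf hg.
have h0 x i j : dom x -> 0 <= lower_bidiag n (d x) (e x) i j.
  move=> dx; rewrite mxE.
  by do 2?[case: ifP => _] => //; [exact: d0 | exact: e0].
split; last first.
  move=> x dx; rewrite det_mxsub_lower_bidiag // prodr_ge0 // => i _.
  exact: h0.
apply: (@eq_computes _ _ _ _ _
    (fun x => \prod_i lower_bidiag n (d x) (e x) (f i) (g i))).
  by move=> x _; rewrite det_mxsub_lower_bidiag.
apply: computes_prod => i _.
case: (eqVneq (f i) (g i)) => [fg|fg].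
  by apply: eq_computes (cd (f i)) => x _; rewrite mxE fg eqxx.
case: (eqVneq (g i).+1 (f i : nat)) => [fg'|fg'].
  by apply: eq_computes (ce (f i)) => x _; rewrite mxE (negbTE fg) fg' eqxx.
apply: eq_computes (computes_int _ _ 0) => x _.
by rewrite mxE (negbTE fg) (negbTE fg').
Qed.

Definition hilbert_mx (F : fieldType) n : 'M[F]_n :=
  \matrix_(i, j) (i + j).+1%:R^-1.

(** Submatrices of the Hilbert matrix are Cauchy matrices, with nodes f i + 1 and g j. *)
Lemma hilbert_minor_gt0 (F : realFieldType) n k (f g : 'I_k -> 'I_n) :
  increasing f -> increasing g -> 0 < \det (mxsub f g (hilbert_mx F n)).
Proof.
move=> hf hg.
rewrite (_ : mxsub _ _ _ = \matrix_(i, j) ((f i).+1%:R + (g j)%:R)^-1).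
  apply: (@det_cauchy_gt0 F k (fun i => (f i).+1%:R) (fun j => (g j)%:R)).
  - by move=> i j ij; rewrite ltr_nat ltnS hf.
  - by move=> i j ij; rewrite ltr_nat hg.
  - by move=> i j; rewrite ltr_pwDl.
by apply/matrixP => i j; rewrite !mxE -natrD addSn.
Qed.

(** These minors do not depend on the data; as rationals they are written into the program, so no
    determinant is evaluated in floating point. *)
Lemma minors_computable_hilbert n : minors_computable (fun=> hilbert_mx R n).
Proof.
move=> k f g hf hg; split=> [|x _]; last exact/ltW/hilbert_minor_gt0.
apply: eq_computes (computes_rat _ _ (\det (mxsub f g (hilbert_mx rat n)))).
move=> x _; rewrite -det_map_mx; congr (\det _).
by apply/matrixP => i j; rewrite !mxE fmorphV /= ratr_nat.
Qed.

Section QAbelGram.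
Context (q alpha : X -> R).
Hypothesis cq : computes q.
Hypothesis calpha : computes alpha.
Hypothesis q0 : forall x, dom x -> 0 < q x.
Hypothesis alpha0 : forall x, dom x -> alpha x <= 0.

Definition qAbel_mx n x : 'M[R]_n.+1 :=
  \matrix_(m, l) (qAbel (q x) (alpha x) m)`_l.

Let node x (r : nat) : R := - (qint (q x) r.+1)^-1.

Lemma qAbel_mxE n x : dom x -> qAbel_mx n x =
  (* The scaling [m]^(m-1) as a diagonal factor; in row 0 it is 1, because [0.-1] is 0. *)
  lower_bidiag n (fun m => qint (q x) m ^+ m.-1) (fun=> 0) *m
  newton_mx n (node x) (- alpha x) n.
Proof.
move=> dx; apply/matrixP => m l; rewrite lower_bidiag_mulmx !mxE.
rewrite mul0r if_same addr0.
case: m l => [[|m] hm] [[|l] hl] /=.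
- by rewrite coef1 mulr1.
- by rewrite coef1 mulr0.
- by rewrite coefXM mulr0.
have hm' : (m <= n)%N by rewrite ltnW.
rewrite (minn_idPr hm') newton_dd_diag -/(qAbel _ _ m.+1) qAbel_coef ?q0 //.
rewrite mulrCA mulrA; congr (_ * _).
by apply: eq_bigr => r _; rewrite /node opprK addrC.
Qed.

Lemma computes_qint m : computes (fun x => qint (q x) m).
Proof.
apply: computes_sum_ge0 => [i x _ dx|i _]; last exact: computesX.
by rewrite exprn_ge0 // ltW // q0.
Qed.

(** Subtracting computed nodes could cancel; [r+1] - [i+1] = q^(i+1) [r-i] removes the
    subtraction. *)
Lemma node_sub x i r : dom x -> (i < r)%N ->
  node x r - node x i = q x ^+ i.+1 * qint (q x) (r - i) /
    (qint (q x) i.+1 * qint (q x) r.+1).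
Proof.
move=> dx ir.
have [i0 r0] : qint (q x) i.+1 != 0 /\ qint (q x) r.+1 != 0.
  by rewrite !gt_eqF // qint_gt0 // q0.
have -> : q x ^+ i.+1 * qint (q x) (r - i) = qint (q x) r.+1 - qint (q x) i.+1.
  have -> : r.+1 = (i.+1 + (r - i))%N by lia.
  by rewrite [qint (q x) (_ + _)]qint_add addrC addKr.
by rewrite /node; field; rewrite i0 r0.
Qed.

Lemma node_sub_gt0 x i r : dom x -> (i < r)%N -> 0 < node x r - node x i.
Proof.
move=> dx ir; rewrite node_sub //.
by rewrite divr_gt0 ?mulr_gt0 ?exprn_gt0 ?qint_gt0 ?q0 // subn_gt0.
Qed.

Lemma computes_node_sub i r : (i < r)%N ->
  computes (fun x => node x r - node x i).
Proof.
move=> ir; apply: eq_computes (fun x dx => esym (node_sub dx ir)) _.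
apply: computes_div.
- by move=> x dx; rewrite mulf_neq0 // gt_eqF // qint_gt0 // q0.
- by apply: computesM; [exact: computesX | exact: computes_qint].
- by apply: computesM; exact: computes_qint.
Qed.

Lemma qint_ge0 x m : dom x -> 0 <= qint (q x) m.
Proof.
by move=> dx; apply: sumr_ge0 => i _; rewrite exprn_ge0 // ltW // q0.
Qed.

Lemma minors_computable_qAbel n : minors_computable (qAbel_mx n).
Proof.
apply: eq_minors_computable (fun x dx => esym (qAbel_mxE n dx)) _.
apply: minors_computable_mul.
  apply: minors_computable_lower_bidiag => [r|r|r x dx|//].
  - exact/computesX/computes_qint.
  - exact: (computes_int _ _ 0).
  - by rewrite exprn_ge0 // qint_ge0.
suff newton_mc i :
  minors_computable (fun x => newton_mx n (node x) (- alpha x) i) by [].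
elim: i => [|i IH].
  apply: (@eq_minors_computable _ (fun=> lower_bidiag n (fun=> 1) (fun=> 0))).
    move=> x _; rewrite newton_mx0; apply/matrixP => r c; rewrite !mxE if_same.
    by case: eqP.
  apply: minors_computable_lower_bidiag => [r|r|r x dx|//] //.
  - exact: (computes_int _ _ 1).
  - exact: (computes_int _ _ 0).
apply: eq_minors_computable (fun x _ => esym (newton_mxS n (node x) _ i)) _.
apply: minors_computable_mul IH.
apply: minors_computable_lower_bidiag => [r|r|r x dx|r x dx].
- case: leqP => [_|ir]; first exact: (computes_int _ _ 1).
  by apply: computes_node_sub; lia.
- case: leqP => [_|ir]; first exact: (computes_int _ _ 0).
  exact: computesN.
- by case: leqP => [//|ir]; rewrite ltW // node_sub_gt0 //; lia.
(* Here alpha <= 0 enters: the subdiagonal entries are - alpha. *)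
- by case: leqP => [//|ir]; rewrite oppr_ge0 alpha0.
Qed.

(** The coefficient matrix is lower triangular with positive diagonal, and so are its principal
    submatrices. This supplies a strictly positive term in Cauchy-Binet. *)
Lemma qAbel_minor_diag_gt0 n x k (f : 'I_k -> 'I_n.+1) : dom x ->
  increasing f -> 0 < \det (mxsub f f (qAbel_mx n x)).
Proof.
move=> dx hf; rewrite det_trig.
  apply: prodr_gt0 => i _; rewrite !mxE; case: (f i : nat) => [|m].
    by rewrite qAbel_coef00.
  rewrite qAbel_coef ?q0 // subnn mul1r mulr_gt0 //.
    by rewrite exprn_gt0 // qint_gt0 // q0.
  apply: prodr_gt0 => r _; have := node_sub_gt0 dx (ltn_ord r).
  by rewrite /node opprK addrC.
apply/is_trig_mxP => i j ij; rewrite !mxE.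
have /leq_sizeP -> // := @size_qAbel _ (q x) (alpha x) (f i) (q0 dx).
exact: hf.
Qed.

Lemma gramE n x : dom x -> gram n (q x) (alpha x) =
  qAbel_mx n x *m (hilbert_mx R n.+1 *m (qAbel_mx n x)^T).
Proof.
move=> dx; apply/matrixP => i j; rewrite mxE.
rewrite (@Rintegral_polyM01 _ n.+1); last 2 first.
- by apply: leq_trans (size_qAbel _ _ (q0 dx)) _.
- by apply: leq_trans (size_qAbel _ _ (q0 dx)) _.
rewrite mxE; apply: eq_bigr => a _; rewrite !mxE mulr_sumr.
apply: eq_bigr => b _; rewrite !mxE; ring.
Qed.

Lemma minors_computable_gram n :
  minors_computable (fun x => gram n (q x) (alpha x)).
Proof.
apply: eq_minors_computable (fun x dx => esym (gramE n dx)) _.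
apply: minors_computable_mul; first exact: minors_computable_qAbel.
apply: minors_computable_mul; first exact: minors_computable_hilbert.
exact/minors_computable_tr/minors_computable_qAbel.
Qed.

(** In both uses of Cauchy-Binet all terms are nonnegative. Other minors of L may vanish, for
    instance when alpha = 0, but its principal minors and all Hilbert minors are positive, so the
    terms for [g] and [f] are positive. *)
Lemma gram_stp n x : dom x ->
  strictly_totally_positive (gram n (q x) (alpha x)).
Proof.
move=> dx k f g hf hg; rewrite gramE // det_mxsub_mulmx.
have mL := @minors_computable_qAbel n.
have posHL (h : 'I_k -> 'I_n.+1) : increasing h ->
    0 < \det (mxsub h g (hilbert_mx R n.+1 *m (qAbel_mx n x)^T)).
  move=> hh; rewrite det_mxsub_mulmx (bigD1 (finfun g)) ?incr_finfun //=.
  have tr (h' : 'I_k -> 'I_n.+1) : \det (mxsub h' g (qAbel_mx n x)^T) =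
      \det (mxsub g h' (qAbel_mx n x)).
    by rewrite -[LHS]det_tr; congr (\det _); apply/matrixP => i j; rewrite !mxE.
  apply: ltr_pwDl.
    rewrite mulr_gt0 ?hilbert_minor_gt0 //; first exact/incrP/incr_finfun.
    rewrite tr (_ : mxsub _ _ _ = mxsub g g (qAbel_mx n x)).
      exact: qAbel_minor_diag_gt0.
    by apply/matrixP => i j; rewrite !mxE ffunE.
  apply: sumr_ge0 => h' /andP[/incrP ih' _]; apply: mulr_ge0.
    exact/ltW/hilbert_minor_gt0.
  by rewrite tr; exact: (mL k g h' hg ih').2.
rewrite (bigD1 (finfun f)) ?incr_finfun //=; apply: ltr_pwDl.
  apply: mulr_gt0; last exact/posHL/incrP/incr_finfun.
  rewrite (_ : mxsub _ _ _ = mxsub f f (qAbel_mx n x)).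
    exact: qAbel_minor_diag_gt0.
  by apply/matrixP => i j; rewrite !mxE ffunE.
apply: sumr_ge0 => h /andP[/incrP ih _]; apply: mulr_ge0.
  exact: (mL k f h hf ih).2.
exact/ltW/posHL.
Qed.

End QAbelGram.
End ComputableMinors.

(** * Neville elimination *)

Section NevilleElimination.
Context (R : realType) (n : nat).
Implicit Types (A : 'M[R]_n.+1) (i j r c : 'I_n.+1) (k : nat).

Definition window (k s : nat) (t : 'I_k) : 'I_n.+1 := inord (s + t).

Lemma window_increasing k s : (s + k <= n.+1)%N -> increasing (@window k s).
Proof.
move=> sk i j ij; have hi := ltn_ord i; have hj := ltn_ord j.
by rewrite !inordK; lia.
Qed.

(** Consecutive rows and initial columns: the minors whose quotients are the relevant entries of
    Neville elimination. *)
Definition window_minor A k s := \det (mxsub (@window k s) (@window k 0) A).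

Lemma window_minor_gt0 A k s : strictly_totally_positive A ->
  (s + k <= n.+1)%N -> 0 < window_minor A k s.
Proof. by move=> hA sk; apply: hA; apply: window_increasing; lia. Qed.

(** Replacing row i of the larger minor by the combination [u] of rows i-k, ..., i does not change
    it, as u has coefficient 1 at i. The new row is zero in the first k columns, so expansion along
    it leaves one entry times the smaller minor. *)
Lemma window_minor_row A k i (u : 'rV[R]_n.+1) :
  (k <= i)%N -> u ord0 i = 1 ->
  (forall r, u ord0 r != 0 -> (i - k <= r <= i)%N) ->
  (forall j, (j < k)%N -> (u *m A) ord0 j = 0) ->
  (u *m A) ord0 (inord k) * window_minor A k (i - k) =
    window_minor A k.+1 (i - k).
Proof.
move=> ki u1 usupp uA0; have hi := ltn_ord i.
pose M := mxsub (@window k.+1 (i - k)) (@window k.+1 0) A.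
pose E : 'M[R]_k.+1 := \matrix_(a, b)
  (if a == ord_max then u ord0 (window (i - k) b) else (a == b)%:R).
have wmax : window (i - k) (@ord_max k) = i.
  by apply: val_inj; rewrite /= inordK; rewrite subnK.
have detE : \det E = 1.
  rewrite det_trig ?big1 // => [a _|].
    by rewrite mxE; case: eqP => [->|_]; [rewrite wmax | rewrite eqxx].
  apply/is_trig_mxP => a b ab; rewrite mxE ifN; last first.
    by rewrite -val_eqE /=; have := ltn_ord b; lia.
  by rewrite -val_eqE ltn_eqF.
have EMmax b : (E *m M) ord_max b = (u *m A) ord0 (window 0 b).
  rewrite mxE [RHS]mxE (bigID (fun r : 'I_n.+1 => (i - k <= r <= i)%N)) /=.
  rewrite [X in _ = _ + X]big1 ?addr0 => [|r hr]; last first.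
    have [->|/usupp h] := eqVneq (u ord0 r) 0; first by rewrite mul0r.
    by rewrite h in hr.
  rewrite (reindex_onto (@window k.+1 (i - k))
    (fun r : 'I_n.+1 => inord (r - (i - k)))) /=; last first.
    move=> r hr; apply: val_inj => /=; rewrite inordK inordK; lia.
  apply: eq_big => [t|t _]; last by rewrite !mxE eqxx.
  have ht := ltn_ord t; rewrite /window.
  have vt : (inord (i - k + t) : 'I_n.+1) = (i - k + t)%N :> nat.
    by rewrite inordK; lia.
  rewrite vt -val_eqE /= inordK; lia.
have EMlift a b : (E *m M) (lift ord_max a) b = M (lift ord_max a) b.
  rewrite mxE (bigD1 (lift ord_max a)) //= mxE ifN; last first.
    by rewrite eq_sym neq_lift.
  rewrite eqxx mul1r big1 ?addr0 // => l la.
  by rewrite mxE ifN ?[_ == l]eq_sym ?(negbTE la) ?mul0r // eq_sym neq_lift.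
rewrite /window_minor -/M -[RHS]mul1r -detE -det_mulmx.
rewrite (expand_det_row _ ord_max) (bigD1 ord_max) //= [X in _ + X]big1.
  rewrite addr0 EMmax /cofactor addnn -mul2n exprM sqrrN expr1n expr1n mul1r.
  rewrite /window add0n; congr (_ * \det _).
  apply/matrixP => a b; rewrite [RHS]mxE [RHS]mxE EMlift !mxE.
  by rewrite /window !lift_max.
move=> b bm; rewrite EMmax uA0 ?mul0r //.
have hb : (b < k)%N.
  have := ltn_ord b; rewrite ltnS leq_eqVlt => /predU1P[e|//].
  by case/eqP: bm; apply: val_inj.
by rewrite /window add0n inordK; lia.
Qed.

Lemma val_prev_row i : prev_row i = i.-1 :> nat.
Proof. by rewrite /prev_row inordK // (leq_ltn_trans (leq_pred i)). Qed.

(** The combination [u] and the zeros are carried through one induction, because together they yield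
    the determinantal formula that keeps the next divisor nonzero. *)
Lemma neville_row A k i : strictly_totally_positive A -> (k <= i)%N ->
  exists u : 'rV[R]_n.+1, [/\ u ord0 i = 1,
    forall r, u ord0 r != 0 -> (i - k <= r <= i)%N,
    row i (neville A k) = u *m A &
    forall j, (j < k)%N -> neville A k i j = 0].
Proof.
move=> hA; elim: k i => [|k IH] i ki.
  exists (delta_mx ord0 i); split=> //.
  - by rewrite mxE !eqxx.
  - move=> r; rewrite mxE eqxx /=.
    case: (eqVneq r i) => [->|_]; last by rewrite eqxx.
    by rewrite subn0 leqnn.
  - by rewrite rowE.
have hi := ltn_ord i.
have [u [u1 us uA u0]] := IH i (ltnW ki).
have kp : (k <= prev_row i)%N by rewrite val_prev_row; lia.
have [v [v1 vs vA v0]] := IH (prev_row i) kp.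
have vE j : neville A k (prev_row i) j = (v *m A) ord0 j by rewrite -vA mxE.
(* The divisor is a quotient of positive window minors, so the nonzero test of the elimination
   succeeds. *)
have pk0 : neville A k (prev_row i) (inord k) != 0.
  have h := window_minor_row kp v1 vs.
  have := window_minor_gt0 (k := k.+1) (s := prev_row i - k) hA.
  rewrite -h => [|j jk]; last by rewrite -vE v0.
  have := val_prev_row i; move=> -> /(_ _)/lt0r_neq0.
  rewrite mulf_eq0 negb_or -vE => /(_ _)/andP[] //; lia.
pose m := neville A k i (inord k) / neville A k (prev_row i) (inord k).
have newE j : neville A k.+1 i j =
    neville A k i j - m * neville A k (prev_row i) j.
  (* The step leaves columns j < k alone; the formula holds there because both entries are already
     0. *)
  rewrite [LHS]mxE ki /= pk0 andbT; case: leqP => [//|jk].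
  by rewrite u0 // v0 // mulr0 subr0.
exists (u - m *: v); split.
- rewrite !mxE u1 (_ : v ord0 i = 0) ?mulr0 ?subr0 //.
  by apply/eqP; apply: contraT => /vs; rewrite val_prev_row; lia.
- move=> r; rewrite !mxE; have [->|/us hr _] := eqVneq (u ord0 r) 0; last lia.
  have [->|/vs hr _] := eqVneq (v ord0 r) 0; first by rewrite mulr0 subr0 eqxx.
  by move: hr; rewrite val_prev_row; lia.
- rewrite mulmxBl -scalemxAl -uA -vA; apply/rowP => j.
  by rewrite [LHS]mxE newE !mxE.
- move=> j; rewrite ltnS leq_eqVlt newE => /predU1P[jk|jk].
    have -> : j = inord k by apply: val_inj; rewrite /= inordK; lia.
    by rewrite /m divfK // subrr.
  by rewrite u0 // v0 // mulr0 subr0.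
Qed.

Lemma neville_entry A k i : strictly_totally_positive A -> (k <= i)%N ->
  neville A k i (inord k) =
  window_minor A k.+1 (i - k) / window_minor A k (i - k).
Proof.
move=> hA ki; have hi := ltn_ord i.
have [u [u1 us uA u0]] := neville_row hA ki.
have uE j : neville A k i j = (u *m A) ord0 j by rewrite -uA mxE.
rewrite -(window_minor_row ki u1 us) => [|j jk]; last by rewrite -uE u0.
rewrite -uE mulfK // gt_eqF // window_minor_gt0 //; lia.
Qed.

Lemma neville_entry_gt0 A k i : strictly_totally_positive A -> (k <= i)%N ->
  0 < neville A k i (inord k).
Proof.
move=> hA ki; have hi := ltn_ord i.
by rewrite neville_entry // divr_gt0 // window_minor_gt0 //; lia.
Qed.

Lemma neville_step_row A k i j : strictly_totally_positive A -> (k < i)%N ->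
  neville A k.+1 i j = neville A k i j -
    multiplier A i (inord k) * neville A k (prev_row i) j.
Proof.
move=> hA ki; have hi := ltn_ord i.
have kp : (k <= prev_row i)%N by rewrite val_prev_row; lia.
have [_ [_ _ _ u0]] := neville_row hA (ltnW ki).
have [_ [_ _ _ v0]] := neville_row hA kp.
rewrite /multiplier inordK; last by lia.
rewrite [LHS]mxE ki /= gt_eqF ?neville_entry_gt0 // andbT.
by case: leqP => [//|jk]; rewrite (u0 j) // (v0 j) // mulr0 subr0.
Qed.

Lemma bd_lowerE A k : bd_lower A k = lower_bidiag n (fun=> 1)
  (fun r : nat =>
     if (k <= r)%N then multiplier A (inord r) (inord (r - k)) else 0).
Proof.
apply/matrixP => r c; rewrite !mxE inord_val; case: eqP => // _.
by case: eqP.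
Qed.

(* Row r of F_i ... F_1 U is row r of A^(r - i + 1), for r >= i. *)
Definition neville_rows A k : 'M[R]_n.+1 :=
  \matrix_(r, c) neville A (r - k) r c.

(** For r > k, adding the multiplier times the previous row undoes one elimination step of row r.
    Rows r <= k stay, both truncated differences being 0. *)
Lemma bd_lower_neville_rows A k : strictly_totally_positive A ->
  bd_lower A k.+1 *m neville_rows A k = neville_rows A k.+1.
Proof.
move=> hA; apply/matrixP => r c; rewrite bd_lowerE lower_bidiag_mulmx.
rewrite mul1r !mxE inord_val; case: eqP => [r0|/eqP r0].
  by rewrite addr0 r0 !sub0n.
case: leqP => [rk|kr].
  by rewrite mul0r addr0; congr (neville _ _ _ _); lia.
have -> : inord r.-1 = prev_row r by [].
rewrite val_prev_row (_ : r.-1 - k = r - k.+1)%N; last lia.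
rewrite (_ : r - k = (r - k.+1).+1)%N; last lia.
by rewrite neville_step_row ?subrK //; lia.
Qed.

Definition bd_lower_prod A k : 'M[R]_n.+1 :=
  \prod_(i <- rev (iota 1 k)) bd_lower A i.

Lemma bd_lower_prodS A k :
  bd_lower_prod A k.+1 = bd_lower A k.+1 *m bd_lower_prod A k.
Proof.
rewrite /bd_lower_prod -(addn1 k) iotaD rev_cat big_cat /=.
by rewrite big_seq1 add1n addn1.
Qed.

Lemma bd_lower_prod_neville_rows A k : strictly_totally_positive A ->
  bd_lower_prod A k *m neville_rows A 0 = neville_rows A k.
Proof.
move=> hA; elim: k => [|k IH].
  by rewrite /bd_lower_prod big_nil mul1mx.
by rewrite bd_lower_prodS -mulmxA IH bd_lower_neville_rows.
Qed.

Definition unit_lower (L : 'M[R]_n.+1) :=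
  forall r c, (r <= c)%N -> L r c = (r == c)%:R.

Lemma unit_lower_mul (L M : 'M[R]_n.+1) :
  unit_lower L -> unit_lower M -> unit_lower (L *m M).
Proof.
move=> hL hM r c rc; rewrite mxE (bigD1 r) //= hL // eqxx mul1r hM //.
rewrite big1 ?addr0 // => l lr; have [lr'|rl] := leqP l r.
  have lc : (l < c)%N by rewrite (leq_trans _ rc) // ltn_neqAle lr lr'.
  by rewrite [M l c]hM 1?ltnW // -val_eqE ltn_eqF // mulr0.
by rewrite hL 1?ltnW // eq_sym (negbTE lr) mul0r.
Qed.

Lemma bd_lower_prod_unit A k : unit_lower (bd_lower_prod A k).
Proof.
elim: k => [|k IH]; first by move=> r c _; rewrite /bd_lower_prod big_nil mxE.
rewrite bd_lower_prodS; apply: unit_lower_mul => // r c rc.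
rewrite mxE; case: eqP => // _; case: eqP => // e; lia.
Qed.

(** If the rows of W before r vanish, row r of L W is row r of W; by symmetry it is also column r of
    L W, where W contributes only entries on or below its diagonal, all zero. *)
Lemma unit_lower_sym_eq0 (L W : 'M[R]_n.+1) : unit_lower L ->
  (forall r c, (c <= r)%N -> W r c = 0) -> (L *m W)^T = L *m W -> W = 0.
Proof.
move=> hL hW sym; suff W0 k r c : (r < k)%N -> W r c = 0.
  by apply/matrixP => r c; rewrite mxE (W0 n.+1).
elim: k r c => // k IH r c rk.
have rowr d : (L *m W) r d = W r d.
  rewrite mxE (bigD1 r) //= hL // eqxx mul1r big1 ?addr0 // => l lr.
  have [ll|rl] := ltnP l r; first by rewrite (IH l) ?mulr0 // (leq_trans ll).
  by rewrite hL // eq_sym (negbTE lr) mul0r.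
rewrite -rowr -sym mxE mxE big1 // => l _.
have [ll|rl] := ltnP l r; first by rewrite (IH l) ?mulr0 // (leq_trans ll).
by rewrite hW ?mulr0.
Qed.

(** Neville elimination gives A = L U with the pivots on the diagonal of U. Then U - D L^T is
    strictly upper triangular and L (U - D L^T) = A - L D L^T is symmetric, hence U = D L^T. *)
Lemma ldl_decomposition A : strictly_totally_positive A -> A^T = A ->
  A = bd_lower_prod A n *m bd_diag A *m (bd_lower_prod A n)^T.
Proof.
move=> hA symA; set L := bd_lower_prod A n.
have hL : unit_lower L by exact: bd_lower_prod_unit.
have LU : A = L *m neville_rows A 0.
  rewrite bd_lower_prod_neville_rows //; apply/matrixP => r c; rewrite mxE.
  by rewrite (_ : r - n = 0)%N //; have := ltn_ord r; lia.
pose W := neville_rows A 0 - bd_diag A *m L^T.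
suff W0 : W = 0.
  by rewrite -mulmxA {1}LU; congr (_ *m _); apply/eqP; rewrite -subr_eq0 -/W W0.
have symD : (L *m (bd_diag A *m L^T))^T = L *m (bd_diag A *m L^T).
  by rewrite !trmx_mul trmxK tr_diag_mx mulmxA.
apply: (@unit_lower_sym_eq0 L) => // [r c cr|]; last first.
  by rewrite /W mulmxBr -LU linearB /= symA symD.
rewrite /W mxE [X in _ + X]mxE mul_diag_mx !mxE hL // subn0.
have [u [_ _ _ u0]] := neville_row hA (leqnn r).
case: (eqVneq c r) => [->|cr']; first by rewrite mulr1 subrr.
by rewrite u0 ?mulr0 ?subr0 // ltn_neqAle cr'.
Qed.

Lemma trmx_prod_rev (s : seq nat) (f : nat -> 'M[R]_n.+1) :
  (\prod_(i <- rev s) f i)^T = \prod_(i <- s) (f i)^T.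
Proof.
elim: s => [|a s IH]; first by rewrite !big_nil trmx1.
by rewrite rev_cons -cats1 big_cat big_seq1 big_cons trmx_mul IH.
Qed.

Lemma bidiagonal_decomposition A : strictly_totally_positive A -> A^T = A ->
  is_bidiagonal_decomposition A
    (fun k : 'I_(n + n.+1) => nth 0 (bd_factors A) k).
Proof.
move=> hA symA; split=> //.
have szf : size (bd_factors A) = (n + n.+1)%N.
  by rewrite size_cat /= !size_map size_rev size_iota.
rewrite -(big_mkord xpredT (fun k => nth 0 (bd_factors A) k)) -szf.
rewrite -(big_nth 0 xpredT id) /bd_factors big_cat big_cons !big_map /=.
rewrite [LHS]ldl_decomposition // -mulmxA /bd_lower_prod trmx_prod_rev.
by rewrite symA.
Qed.

End NevilleElimination.

Section ComputableNeville.
Context (R : realType) (X : Type) (N : nat) (input : X -> store R).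
Context (dom : X -> Prop) (n : nat) (A : X -> 'M[R]_n.+1).
Local Notation computes := (computes N input dom).
Hypothesis mA : minors_computable N input dom A.
Hypothesis stpA : forall x, dom x -> strictly_totally_positive (A x).
Hypothesis symA : forall x, dom x -> (A x)^T = A x.

Lemma computes_neville (k : nat) (i : 'I_n.+1) : (k <= i)%N ->
  computes (fun x => neville (A x) k i (inord k)).
Proof.
move=> ki; have hi := ltn_ord i.
have cw l s : (s + l <= n.+1)%N -> computes (fun x => window_minor (A x) l s).
  by move=> sl; apply: (mA _ _).1; apply: window_increasing; lia.
apply: (@eq_computes _ _ _ _ _ (fun x =>
    window_minor (A x) k.+1 (i - k) / window_minor (A x) k (i - k))).
  by move=> x dx; rewrite -neville_entry //; exact: stpA.
apply: computes_div; try by apply: cw; lia.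
by move=> x dx; apply/lt0r_neq0/window_minor_gt0; [exact: stpA | lia].
Qed.

Lemma computes_multiplier (k : nat) (i : 'I_n.+1) : (k < i)%N ->
  computes (fun x => multiplier (A x) i (inord k)).
Proof.
move=> ki; have hi := ltn_ord i; have vp := val_prev_row i.
have vk : (inord k : 'I_n.+1) = k :> nat by rewrite inordK; lia.
apply: (@eq_computes _ _ _ _ _ (fun x =>
    neville (A x) k i (inord k) / neville (A x) k (prev_row i) (inord k))).
  by move=> x _; rewrite /multiplier vk.
apply: computes_div.
- by move=> x dx; apply/lt0r_neq0/neville_entry_gt0; [exact: stpA | lia].
- by apply: computes_neville; lia.
- by apply: computes_neville; lia.
Qed.

Lemma computes_bd_lower k (r c : 'I_n.+1) : (0 < k)%N ->
  computes (fun x => bd_lower (A x) k r c).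
Proof.
move=> k0; case: (eqVneq r c) => [rc|rc].
  by apply: eq_computes (computes_int _ _ 1) => x _; rewrite mxE rc eqxx.
case h : ((c.+1 == r) && (k <= r))%N.
  apply: (@eq_computes _ _ _ _ _
      (fun x => multiplier (A x) r (inord (r - k)))).
    by move=> x _; rewrite mxE (negbTE rc) h.
  by apply: computes_multiplier; case/andP: h => _; lia.
apply: eq_computes (computes_int _ _ 0) => x _.
by rewrite mxE (negbTE rc) h.
Qed.

Lemma computes_bd_diag (r c : 'I_n.+1) :
  computes (fun x => bd_diag (A x) r c).
Proof.
case: (eqVneq r c) => [<-|rc]; last first.
  by apply: eq_computes (computes_int _ _ 0) => x _; rewrite !mxE (negbTE rc).
apply: eq_computes (computes_neville (leqnn r)) => x _.
by rewrite !mxE eqxx inord_val.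
Qed.

Lemma computes_bd_factors k (r c : 'I_n.+1) :
  computes (fun x => nth 0 (bd_factors (A x)) k r c).
Proof.
have c0 : computes (fun=> 0) by exact: (computes_int _ _ 0).
have sz (B : 'M[R]_n.+1) :
  size [seq bd_lower B i | i <- rev (iota 1 n)] = n.
  by rewrite size_map size_rev size_iota.
have [kn|nk] := ltnP k n.
  apply: (@eq_computes _ _ _ _ _ (fun x => bd_lower (A x) (n - k) r c)).
    move=> x _; rewrite nth_cat sz kn (nth_map 0%N) ?size_rev ?size_iota //.
    rewrite nth_rev ?size_iota // nth_iota; last lia.
    by rewrite (_ : 1 + (n - k.+1) = n - k)%N //; lia.
  by apply: computes_bd_lower; lia.
have [kn|] := eqVneq k n.
  apply: eq_computes (computes_bd_diag r c) => x _.
  by rewrite nth_cat sz kn ltnn subnn.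
move=> kn; have {kn}kn : (0 < k - n)%N by lia.
have [k2|k2] := ltnP (k - n).-1 n; last first.
  apply: eq_computes c0 => x _.
  rewrite nth_default ?mxE // size_cat /= !size_map size_rev size_iota; lia.
apply: (@eq_computes _ _ _ _ _ (fun x => bd_lower (A x) (k - n) c r)).
  move=> x dx; rewrite nth_cat sz ltnNge nk /=.
  case: (k - n)%N k2 kn => [|m] //= mn _.
  by rewrite (nth_map 0%N) ?size_iota // nth_iota // [RHS]mxE symA.
by apply: computes_bd_lower; lia.
Qed.
End ComputableNeville.

(** * Eigenvalues *)

Section Diagonalization.
Context (R : realType).
Local Notation toC := (real_complex R).

Lemma sort_ord_perm n (d : 'I_n -> R) :
  exists s : 'S_n, {homo d \o s : i j / (i <= j)%N >-> j <= i}.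
Proof.
pose ge (x y : R) := y <= x.
pose t := [tuple of sort ge [tuple d i | i < n]].
have /tuple_permP[s es] : perm_eq t [tuple d i | i < n] by rewrite perm_sort.
have tE i : tnth t i = d (s i).
  have := congr1 (fun u => nth (d i) u i) es.
  by rewrite -!tnth_nth !tnth_mktuple.
exists s => i j ij; rewrite /= -!tE !(tnth_nth (d i)).
have st : sorted ge t by apply: sort_sorted => x y; exact: le_total.
have tr : transitive ge by move=> x y z xy zx; exact: le_trans zx xy.
have /(_ i j) := sorted_leq_nth tr (fun x => lexx x) (d i) st.
by rewrite !inE size_tuple !ltn_ord; apply.
Qed.

(** Only similarity over the complex numbers is recorded; it determines the characteristic
    polynomial and the traces of powers and compounds. *)
Definition diagonalized_by n (A : 'M[R]_n) (lam : 'I_n -> R) :=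
  exists P Q : 'M[R[i]]_n, P *m Q = 1%:M /\
    map_mx toC A = Q *m diag_mx (\row_i toC (lam i)) *m P.

Lemma symmetric_diagonalization n (A : 'M[R]_n) : A^T = A ->
  exists2 lam, diagonalized_by A lam &
    {homo lam : i j / (i <= j)%N >-> j <= i}.
Proof.
move=> symA; pose B := map_mx toC A.
have Breal i j : B i j \is Num.real.
  by rewrite mxE; apply/complex_realP; exists (A i j).
have Bherm : B \is hermsymmx.
  have symB : B^T = B by rewrite map_trmx symA.
  apply/is_hermitianmxP; rewrite expr0 scale1r; apply/matrixP => i j.
  by rewrite [RHS]mxE symB conj_Creal.
have /orthomx_spectralP eB := hermitian_normalmx Bherm.
have /mxOverP dreal := hermitian_spectral_diag_real Bherm.
have /= [d dE] : exists d : 'I_n -> R,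
    forall i, spectral_diag B ord0 i = toC (d i).
  have [d dE] := choice (fun i => elimT (complex_realP _) (dreal ord0 i)).
  by exists d.
have [s hs] := sort_ord_perm d; exists (d \o s) => //.
have Qu := spectral_unit B; set Q := spectralmx B in eB Qu.
exists (perm_mx s *m Q), (invmx Q *m perm_mx s^-1); split.
  by rewrite mulmxA -[_ *m invmx Q]mulmxA mulmxV // mulmx1 -perm_mxM mulgV
    perm_mx1.
have -> : diag_mx (\row_i toC ((d \o s) i)) =
    perm_mx s *m diag_mx (spectral_diag B) *m perm_mx s^-1.
  rewrite -col_permE -row_permE; apply/matrixP => i j.
  by rewrite !mxE (inj_eq perm_inj) dE.
have ss : perm_mx s^-1 *m perm_mx s = 1%:M :> 'M[R[i]]_n.
  by rewrite -perm_mxM mulVg perm_mx1.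
rewrite !mulmxA -[_ *m perm_mx s^-1 *m perm_mx s]mulmxA ss mulmx1.
by rewrite -[_ *m perm_mx s^-1 *m perm_mx s]mulmxA ss mulmx1.
Qed.

Lemma char_poly_conj (F : comNzRingType) n (P Q D : 'M[F]_n) :
  P *m Q = 1%:M -> char_poly (Q *m D *m P) = char_poly D.
Proof.
move=> PQ; pose toP := @map_mx _ _ (@polyC F) n n.
have QP' : toP Q *m toP P = 1%:M.
  by rewrite -map_mxM (mulmx1C PQ) map_mx1.
rewrite /char_poly.
have -> : char_poly_mx (Q *m D *m P) = toP Q *m char_poly_mx D *m toP P.
  rewrite /char_poly_mx mulmxBr mulmxBl scalar_mxC -(mulmxA _ (toP Q)) QP'.
  by rewrite mulmx1 !map_mxM.
rewrite !det_mulmx mulrAC -det_mulmx QP' det1 mul1r.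
by [].
Qed.

Lemma char_poly_diag (F : comNzRingType) n (d : 'rV[F]_n) :
  char_poly (diag_mx d) = \prod_i ('X - (d ord0 i)%:P).
Proof.
rewrite char_poly_trig ?diag_mx_is_trig //.
by apply: eq_bigr => i _; rewrite mxE eqxx.
Qed.

Lemma diagonalized_char_poly n (A : 'M[R]_n) lam : diagonalized_by A lam ->
  char_poly A = \prod_i ('X - (lam i)%:P).
Proof.
move=> [P [Q [PQ eA]]]; apply: (map_poly_inj toC).
rewrite map_char_poly eA char_poly_conj // char_poly_diag rmorph_prod.
by apply: eq_bigr => i _; rewrite mxE rmorphB /= map_polyX map_polyC.
Qed.

Lemma mul_diag_mx_diag (F : comNzRingType) n (d e : 'rV[F]_n) :
  diag_mx d *m diag_mx e = diag_mx (\row_i (d ord0 i * e ord0 i)).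
Proof.
apply/matrixP => i j; rewrite mul_diag_mx !mxE.
by case: eqP => [->|_]; rewrite ?mulr0n ?mulr0.
Qed.

Lemma diagonalized_sq n (A : 'M[R]_n) lam : diagonalized_by A lam ->
  diagonalized_by (A *m A) (fun i => lam i ^+ 2).
Proof.
move=> [P [Q [PQ eA]]]; exists P, Q; split=> //.
rewrite map_mxM eA !mulmxA -[_ *m P *m Q]mulmxA PQ mulmx1.
rewrite -[Q *m _ *m _]mulmxA mul_diag_mx_diag.
congr (Q *m diag_mx _ *m P); apply/rowP => i.
by rewrite !mxE rmorphXn.
Qed.

Lemma diagonalized_iter_sq n (A : 'M[R]_n) lam j : diagonalized_by A lam ->
  diagonalized_by (iter j (@mxsq R n) A) (fun i => lam i ^+ (2 ^ j)).
Proof.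
move=> dA; elim: j => [//|j IH] /=.
have [P [Q [PQ e]]] := diagonalized_sq IH.
exists P, Q; split=> //; rewrite [LHS]e.
congr (Q *m diag_mx _ *m P); apply/rowP => i.
by rewrite !mxE -exprM -expnSr.
Qed.

Definition incr_pred k n := [pred h : {ffun 'I_k -> 'I_n} | incr h].

Definition nth_incr k n (i : 'I_#|incr_pred k n|) : {ffun 'I_k -> 'I_n} :=
  enum_val i.

Lemma nth_incr_increasing k n (i : 'I_#|incr_pred k n|) :
  increasing (nth_incr i).
Proof. exact/incrP/(enum_valP i). Qed.

Definition compound (F : comNzRingType) k n (A : 'M[F]_n) :
    'M[F]_#|incr_pred k n| :=
  \matrix_(i, j) \det (mxsub (nth_incr i) (nth_incr j) A).

Lemma compound_mul (F : comNzRingType) k n (A B : 'M[F]_n) :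
  compound k (A *m B) = compound k A *m compound k B.
Proof.
apply/matrixP => i j; rewrite !mxE det_mxsub_mulmx.
rewrite (big_enum_val (fun h : {ffun 'I_k -> 'I_n} =>
  \det (mxsub (nth_incr i) h A) * \det (mxsub h (nth_incr j) B))).
by apply: eq_bigr => l _; rewrite !mxE.
Qed.

Lemma compound_diag (F : comNzRingType) k n (d : 'rV[F]_n) :
  compound k (diag_mx d) =
  diag_mx (\row_i \prod_t d ord0 (nth_incr i t)).
Proof.
apply/matrixP => i j; rewrite !mxE.
rewrite det_mxsub_diag; try exact: nth_incr_increasing.
case: (eqVneq i j) => [->|ij].
  by apply: eq_bigr => t _; rewrite mxE eqxx.
rewrite mulr0n; have /eqP : nth_incr i != nth_incr j.
  by apply: contra ij => /eqP /enum_val_inj ->.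
move=> e; have [t et] : exists t, nth_incr i t != nth_incr j t.
  apply/existsP; rewrite -negb_forall; apply/negP => /forallP h.
  by apply: e; apply/ffunP => t; apply/eqP.
by rewrite (bigD1 t) //= mxE (negbTE et) mul0r.
Qed.

Lemma compound1 (F : comNzRingType) k n : compound k (1%:M : 'M[F]_n) = 1%:M.
Proof.
rewrite -diag_const_mx compound_diag -diag_const_mx; congr diag_mx.
by apply/rowP => i; rewrite !mxE big1 // => t _; rewrite mxE.
Qed.

(** Compounds are multiplicative by Cauchy-Binet, so they carry the similarity over; the compound of
    a diagonal matrix is diagonal. *)
Lemma diagonalized_trace_compound k n (A : 'M[R]_n) lam :
  diagonalized_by A lam -> \tr (compound k A) =
  \sum_(h : {ffun 'I_k -> 'I_n} | incr h) \prod_t lam (h t).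
Proof.
move=> [P [Q [PQ eA]]]; apply: (@complexI R).
have -> : toC (\tr (compound k A)) = \tr (compound k (map_mx toC A)).
  rewrite rmorph_sum; apply: eq_bigr => i _; rewrite !mxE -det_map_mx.
  by rewrite map_mxsub.
rewrite eA !compound_mul mxtrace_mulC mulmxA -compound_mul PQ compound1 mul1mx.
rewrite compound_diag rmorph_sum.
rewrite (big_enum_val (fun h : {ffun 'I_k -> 'I_n} => toC (\prod_t lam (h t)))).
apply: eq_bigr => i _; rewrite !mxE eqxx mulr1n rmorph_prod.
by apply: eq_bigr => t _; rewrite mxE.
Qed.

Lemma compound_iter_sq k n (A : 'M[R]_n) j :
  iter j (@mxsq R _) (compound k A) = compound k (iter j (@mxsq R n) A).
Proof. by elim: j => [//|j IH] /=; rewrite /mxsq compound_mul -IH. Qed.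

(* The k-th compound matrix has spectral radius lam_1 ... lam_k. *)
Lemma trace_compound_bounds k n (A : 'M[R]_n.+1) lam j :
  diagonalized_by A lam -> {homo lam : i j / (i <= j)%N >-> j <= i} ->
  (forall i, 0 < lam i) -> (k <= n.+1)%N ->
  (\prod_(t < k) lam (inord t)) ^+ (2 ^ j) <=
    \tr (iter j (@mxsq R _) (compound k A)) <=
    #|incr_pred k n.+1|%:R * (\prod_(t < k) lam (inord t)) ^+ (2 ^ j).
Proof.
move=> dA mono lam0 kn; set rho := \prod_(t < k) _.
rewrite compound_iter_sq.
rewrite (diagonalized_trace_compound _ (diagonalized_iter_sq j dA)).
have term_ge0 (h : {ffun 'I_k -> 'I_n.+1}) : 0 <= \prod_t lam (h t) ^+ (2 ^ j).
  by apply: prodr_ge0 => t _; rewrite exprn_ge0 // ltW.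
have rhoE : rho ^+ (2 ^ j) = \prod_(t < k) lam (inord t) ^+ (2 ^ j).
  by rewrite prodrXl.
pose h0 : {ffun 'I_k -> 'I_n.+1} := [ffun t : 'I_k => inord t].
have ih0 : incr h0.
  apply: incr_finfun => s t st; have hs := ltn_ord s; have ht := ltn_ord t.
  by rewrite !inordK //; lia.
apply/andP; split.
  rewrite (bigD1 h0) //= rhoE -[leLHS]addr0 lerD //; last exact: sumr_ge0.
  by apply: ler_prod => t _; rewrite ffunE lexx andbT exprn_ge0 // ltW.
rewrite mulr_natl -sumr_const; apply: ler_sum => h /incrP ih.
rewrite rhoE; apply: ler_prod => t _.
have lam_ge0 i : 0 <= lam i by exact: ltW.
rewrite exprn_ge0 //=; apply: lerXn2r; rewrite ?nnegrE //; apply: mono.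
have ht : (t < n.+1)%N by exact: leq_trans (ltn_ord t) kn.
rewrite inordK //.
(* An increasing h satisfies h m >= m, so the first k eigenvalues give the largest product. *)
have : forall m (mk : (m < k)%N), (m <= h (Ordinal mk))%N.
  elim=> [//|m IH] mk; apply: leq_ltn_trans (IH (ltnW mk)) _.
  exact: ih.
by move/(_ t (ltn_ord t)); congr (_ <= h _)%N; apply: val_inj.
Qed.

(** With A = L D L^T and w = v L nonzero, v A v^T is the sum of the p_a w_a^2 with positive pivots
    p_a; for an eigenvector v it is also the eigenvalue times v v^T > 0. *)
Lemma stp_eigenvalue_gt0 n (A : 'M[R]_n.+1) lam :
  strictly_totally_positive A -> A^T = A -> diagonalized_by A lam ->
  forall i, 0 < lam i.
Proof.
move=> hA symA dA i.
have : root (char_poly A) (lam i).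
  rewrite (diagonalized_char_poly dA) (bigD1 i) //= rootM root_XsubC eqxx //.
rewrite -eigenvalue_root_char => /eigenvalueP[v vA v0].
have sq_sum (w : 'rV[R]_n.+1) : (w *m w^T) ord0 ord0 = \sum_l w ord0 l ^+ 2.
  by rewrite mxE; apply: eq_bigr => l _; rewrite mxE expr2.
have vv : 0 < (v *m v^T) ord0 ord0.
  rewrite sq_sum lt0r sumr_ge0 ?andbT => [|l _]; last exact: sqr_ge0.
  apply: contra v0; rewrite psumr_eq0 => [/allP h|l _]; last exact: sqr_ge0.
  apply/eqP/rowP => l; rewrite [RHS]mxE; apply/eqP.
  by have := h l (mem_index_enum l); rewrite sqrf_eq0.
rewrite -(pmulr_lgt0 _ vv).
have -> : lam i * (v *m v^T) ord0 ord0 = (v *m A *m v^T) ord0 ord0.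
  by rewrite vA -scalemxAl [RHS]mxE.
rewrite (ldl_decomposition hA symA); set L := bd_lower_prod A n.
pose w := v *m L.
have -> : v *m (L *m bd_diag A *m L^T) *m v^T = w *m bd_diag A *m w^T.
  by rewrite /w trmx_mul !mulmxA.
have w0 : w != 0.
  apply: contra v0 => /eqP w0.
  have Lu : L \in unitmx.
    have hL : unit_lower L by exact: bd_lower_prod_unit.
    rewrite unitmxE det_trig.
      by rewrite big1 ?unitr1 // => l _; rewrite hL // eqxx.
    apply/is_trig_mxP => a b ab; rewrite hL 1?ltnW // -val_eqE ltn_eqF //.
  by rewrite -(mulmxK Lu v) -/w w0 mul0mx.
clearbody w; rewrite mul_mx_diag mxE.
have [l wl] : exists l, w ord0 l != 0.
  by apply/rV0Pn.
have pl a : 0 < pivot A a.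
  by have := neville_entry_gt0 hA (leqnn a); rewrite inord_val.
have term a : 0 <= w ord0 a * pivot A a * w ord0 a.
  by rewrite mulrAC -expr2 mulr_ge0 ?sqr_ge0 // ltW.
rewrite (bigD1 l) //= !mxE ltr_pwDl //.
  by rewrite mulrAC -expr2 mulr_gt0 // lt0r sqr_ge0 sqrf_eq0 wl.
by apply: sumr_ge0 => a _; rewrite !mxE.
Qed.

End Diagonalization.

Section ComputableEigenvalues.
Context (R : realType) (X : Type) (N : nat) (input : X -> store R).
Context (dom : X -> Prop) (n : nat) (A : X -> 'M[R]_n.+1).
Local Notation computes := (computes N input dom).
Hypothesis mA : minors_computable N input dom A.
Hypothesis stpA : forall x, dom x -> strictly_totally_positive (A x).
Hypothesis symA : forall x, (A x)^T = A x.

(** The spectral theorem and choice fix the eigenvalues as functions of the data; only then are they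
    shown to be computable, through [rho], with [rho 0] the empty product. *)
Lemma computable_eigenvalues : exists lam : 'I_n.+1 -> X -> R,
  (forall i, computes (lam i)) /\
  forall x, dom x -> [/\ diagonalized_by (A x) (fun i => lam i x),
    {homo (fun i => lam i x) : i j / (i <= j)%N >-> j <= i} &
    forall i, 0 < lam i x].
Proof.
have exlam x : exists lam : 'I_n.+1 -> R, diagonalized_by (A x) lam /\
    {homo lam : i j / (i <= j)%N >-> j <= i}.
  by have [lam h1 h2] := symmetric_diagonalization (symA x); exists lam.
have [lam hlam] := choice exlam.
have lam0 x : dom x -> forall i, 0 < lam x i.
  by move=> dx; apply: stp_eigenvalue_gt0 (stpA dx) (symA x) (hlam x).1.
exists (fun i x => lam x i); split; last first.
  by move=> x dx; have [h1 h2] := hlam x; split=> //; exact: lam0.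
pose rho k x := \prod_(t < k) lam x (inord t).
have rho0 k x : dom x -> 0 < rho k x.
  by move=> dx; apply: prodr_gt0 => t _; exact: lam0.
have crho k : (k <= n.+1)%N -> computes (rho k).
  move=> kn; apply: (@computes_power_limit _ _ _ _ _ _
    (fun x => compound k (A x)) (rho k)
    #|incr_pred k n.+1|).
  - move=> i j; apply: eq_computes (mA (nth_incr_increasing i)
      (nth_incr_increasing j)).1 => x _.
    by rewrite mxE.
  - move=> x i j dx; rewrite mxE.
    by apply: (mA (nth_incr_increasing i) (nth_incr_increasing j)).2.
  - exact: rho0.
  - move=> x j dx; have [h1 h2] := hlam x.
    by apply: trace_compound_bounds => //; exact: lam0.
move=> i; apply: (@eq_computes _ _ _ _ _ (fun x => rho i.+1 x / rho i x)).
  move=> x dx; rewrite /rho big_ord_recr /= inord_val mulrAC divff ?mul1r //.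
  by rewrite gt_eqF // rho0.
apply: computes_div; [|exact: crho (ltn_ord i)|exact: crho (ltnW (ltn_ord i))].
by move=> x dx; rewrite gt_eqF // rho0.
Qed.

End ComputableEigenvalues.

(** * Inverse and linear systems *)

Section ComputableInverse.
Context (R : realType) (X : Type) (N : nat) (input : X -> store R).
Context (dom : X -> Prop) (n : nat) (A : X -> 'M[R]_n.+1).
Local Notation computes := (computes N input dom).
Hypothesis mA : minors_computable N input dom A.
Hypothesis stpA : forall x, dom x -> strictly_totally_positive (A x).

Lemma computes_sign k f : computes f -> computes (fun x => (-1) ^+ k * f x).
Proof.
move=> cf; rewrite -signr_odd; case: (odd k).
  by apply: eq_computes (computesN cf) => x _; rewrite mulN1r.
by apply: eq_computes cf => x _; rewrite mul1r.
Qed.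

Lemma lift_increasing m (i : 'I_m.+1) : increasing (lift i).
Proof.
by move=> j k jk; rewrite /= ltnNge leq_bump2 -ltnNge.
Qed.

Let cofactor_minor x (i j : 'I_n.+1) := \det (mxsub (lift i) (lift j) (A x)).

Lemma stp_det_gt0 x : dom x -> 0 < \det (A x).
Proof.
move=> dx; have := stpA dx (f := id) (g := id).
by rewrite (_ : mxsub _ _ _ = A x); [apply | apply/matrixP => i j; rewrite mxE].
Qed.

Lemma stp_unitmx x : dom x -> A x \in unitmx.
Proof. by move=> dx; rewrite unitmxE unitfE gt_eqF // stp_det_gt0. Qed.

Lemma invmx_minor x i j : dom x ->
  invmx (A x) i j = (-1) ^+ (i + j) * (cofactor_minor x j i / \det (A x)).
Proof.
move=> dx; rewrite /invmx stp_unitmx // !mxE /cofactor mulrCA addnC.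
congr (_ * _); rewrite mulrC; congr (_ / _); congr (\det _).
by apply/matrixP => a b; rewrite !mxE.
Qed.

Lemma computes_invmx i j : computes (fun x => invmx (A x) i j).
Proof.
apply: (@eq_computes _ _ _ _ _ (fun x =>
    (-1) ^+ (i + j) * (cofactor_minor x j i / \det (A x)))).
  by move=> x dx; rewrite invmx_minor.
apply/computes_sign/computes_div.
- by move=> x dx; rewrite gt_eqF // stp_det_gt0.
- by apply: (mA _ _).1; exact: lift_increasing.
- have [] := mA (f := id) (g := id) => // cd _; apply: eq_computes cd => x _.
  by congr (\det _); apply/matrixP => a b; rewrite mxE.
Qed.

Lemma alternating_signs_ord0 (d : 'cV[R]_n.+1) (j : 'I_n.+1) : (0 < n)%N ->
  alternating_signs d -> 0 < (-1) ^+ j * (d ord0 0 * d j 0).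
Proof.
move=> n0 hd.
(* As n > 0, every entry has a neighbour, and their product is nonzero. *)
have d0 i : d i 0 != 0.
  have [i0|i0] := eqVneq i ord0; last first.
    have := hd (inord i.-1) i; rewrite inordK; last by have := ltn_ord i; lia.
    rewrite prednK ?lt0n // => /(_ erefl) h.
    by apply: contraTneq h => ->; rewrite mulr0 ltxx.
  have := hd i (inord i.+1); rewrite i0 inordK // => /(_ erefl) h.
  by apply: contraTneq h => ->; rewrite mul0r ltxx.
suff h k (hk : (k < n.+1)%N) :
    0 < (-1) ^+ k * (d ord0 0 * d (Ordinal hk) 0).
  by have := h j (ltn_ord j); congr (0 < _ * (_ * d _ 0)); apply: val_inj.
elim: k hk => [|k IH] hk.
  rewrite mul1r (_ : Ordinal hk = ord0) -?expr2 ?exprn_even_gt0 ?d0 //.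
  exact: val_inj.
have := IH (ltnW hk); set a := d (Ordinal (ltnW hk)) 0 => h.
have ab : a * d (Ordinal hk) 0 < 0 by apply: hd.
have a2 : 0 < a ^+ 2 by rewrite exprn_even_gt0 //= d0.
rewrite -(pmulr_lgt0 _ a2) exprS.
have := mulr_gt0 h (_ : 0 < - (a * d (Ordinal hk) 0)).
rewrite oppr_gt0 => /(_ ab); congr (0 < _); ring.
Qed.

(** The inverse has checkerboard signs (-1)^(i+j) and d_j has the sign of (-1)^j d_0, so every term
    of row i has the sign of (-1)^i d_0. *)
Lemma computes_solution (d : X -> 'cV[R]_n.+1) i : (0 < n)%N ->
  (forall j, computes (fun x => d x j 0)) ->
  (forall x, dom x -> alternating_signs (d x)) ->
  computes (fun x => (invmx (A x) *m d x) i 0).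
Proof.
move=> n0 cd alt.
apply: (@eq_computes _ _ _ _ _ (fun x =>
    \sum_j invmx (A x) i j * d x j 0)) => [x _|]; first by rewrite mxE.
apply: (@computes_sum _ _ _ _ _ (fun x => (-1) ^+ i * d x ord0 0)).
- move=> x dx; rewrite mulf_neq0 ?signr_eq0 //.
  have := alternating_signs_ord0 ord0 n0 (alt x dx); rewrite mul1r -expr2.
  by move=> h; apply: contraTneq h => ->; rewrite expr0n ltxx.
- move=> j x _ dx; rewrite invmx_minor //.
  set m := cofactor_minor x j i / \det (A x).
  have m0 : 0 < m.
    rewrite divr_gt0 ?stp_det_gt0 //; apply: stpA => //; exact: lift_increasing.
  have -> : (-1) ^+ i * d x ord0 0 * ((-1) ^+ (i + j) * m * d x j 0) =
      m * ((-1) ^+ j * (d x ord0 0 * d x j 0)) * ((-1) ^+ i * (-1) ^+ i).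
    by rewrite exprD; ring.
  rewrite -expr2 sqrr_sign mulr1 mulr_ge0 // ltW //.
  exact: alternating_signs_ord0 n0 (alt x dx).
- by move=> j _; apply: computesM => //; exact: computes_invmx.
Qed.

End ComputableInverse.

Lemma tr_gram (R : realType) n (q alpha : R) :
  (gram n q alpha)^T = gram n q alpha.
Proof.
apply/matrixP => i j; rewrite !mxE; apply: eq_Rintegral => x _.
by rewrite mulrC.
Qed.

Theorem theorem5 (R : realType) (n : nat) (hn : (1 <= n)%N) :
  (forall q alpha : R, 0 < q -> alpha <= 0 ->
     strictly_totally_positive (gram n q alpha)) /\
  (* the Gramian matrix *)
  hra_from_q_alpha (fun (q alpha : R) (t : 'I_n.+1 * 'I_n.+1 -> R) =>
     gram n q alpha = \matrix_(i, j) t (i, j)) /\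
  (* its bidiagonal decomposition *)
  hra_from_q_alpha
    (fun (q alpha : R) (t : 'I_(n + n.+1) * 'I_n.+1 * 'I_n.+1 -> R) =>
     is_bidiagonal_decomposition (gram n q alpha)
       (fun k => \matrix_(i, j) t (k, i, j))) /\
  (* its eigenvalues *)
  hra_from_q_alpha (fun (q alpha : R) (t : 'I_n.+1 -> R) =>
     is_eigenvalues (gram n q alpha) t) /\
  (* its singular values *)
  hra_from_q_alpha (fun (q alpha : R) (t : 'I_n.+1 -> R) =>
     is_singular_values (gram n q alpha) t) /\
  (* its inverse *)
  hra_from_q_alpha (fun (q alpha : R) (t : 'I_n.+1 * 'I_n.+1 -> R) =>
     gram n q alpha \in unitmx /\
     invmx (gram n q alpha) = \matrix_(i, j) t (i, j)) /\
  (* the solution of linear systems *)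
  hra_from_q_alpha_d (@alternating_signs R n.+1)
    (fun (q alpha : R) (d : 'cV[R]_n.+1) (t : 'I_n.+1 -> R) =>
     gram n q alpha *m (\col_i t i) = d).
Proof.
pose input (x : R * R) : store R := fun k => nth 0 [:: x.1; x.2] k.
pose A (x : R * R) := gram n x.1 x.2.
have q0 x : @qalpha_dom R x -> 0 < x.1 by case.
have a0 x : @qalpha_dom R x -> x.2 <= 0 by case.
have cq : computes 2 input (@qalpha_dom R) fst.
  by apply: eq_computes (computes_input input _ (isT : (0 < 2)%N)).
have ca : computes 2 input (@qalpha_dom R) snd.
  by apply: eq_computes (computes_input input _ (isT : (1 < 2)%N)).
have mA : minors_computable 2 input (@qalpha_dom R) A.
  exact: minors_computable_gram.
have stpA x : @qalpha_dom R x -> strictly_totally_positive (A x).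
  by move=> dx; exact: (gram_stp cq ca q0 a0).
have symA x : (A x)^T = A x by exact: tr_gram.
have [lam [clam hlam]] := computable_eigenvalues mA stpA symA.
do ![split].
- by move=> q alpha hq ha; exact: (stpA (q, alpha)).
- apply: (@hra_of_computes _ _ _ 2 _ _ _ (fun ij x => A x ij.1 ij.2)).
    (* Entries are minors of order 1. *)
    move=> [i j]; have [||c _] := mA 1%N (fun=> i) (fun=> j).
    - by move=> [[|//] h] [[|//] h'].
    - by move=> [[|//] h] [[|//] h'].
    by apply: eq_computes c => x _; rewrite det_mx11 mxE.
  by move=> x _; apply/matrixP => i j; rewrite [RHS]mxE.
- apply: (@hra_of_computes _ _ _ 2 _ _ _
    (fun (kij : 'I_(n + n.+1) * 'I_n.+1 * 'I_n.+1) x =>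
       nth 0 (bd_factors (A x)) kij.1.1 kij.1.2 kij.2)).
    by move=> [[k i] j]; apply: computes_bd_factors.
  move=> x dx; have := bidiagonal_decomposition (stpA x dx) (symA x).
  congr is_bidiagonal_decomposition; apply/funext => k.
  by apply/matrixP => i j; rewrite mxE.
- apply: (@hra_of_computes _ _ _ 2 _ _ _ lam) => // x dx.
  by have [h1 h2 _] := hlam x dx; split=> //; exact: diagonalized_char_poly.
- apply: (@hra_of_computes _ _ _ 2 _ _ _ lam) => // x dx.
  have [h1 h2 h3] := hlam x dx; split=> // [i|]; first exact: ltW.
  (* By symmetry A^T A = A^2, with eigenvalues lam_i^2. *)
  by rewrite symA; exact/diagonalized_char_poly/diagonalized_sq.
- apply: (@hra_of_computes _ _ _ 2 _ _ _ (fun ij x => invmx (A x) ij.1 ij.2)).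
    by move=> [i j]; exact: computes_invmx.
  move=> x dx; split; first exact: (stp_unitmx stpA).
  by apply/matrixP => i j; rewrite [RHS]mxE.
pose domd (x : R * R * 'cV[R]_n.+1) :=
  @qalpha_dom R x.1 /\ @alternating_signs R n.+1 x.2.
pose inputd (x : R * R * 'cV[R]_n.+1) : store R := fun k =>
  nth 0 [:: x.1.1, x.1.2 & [seq x.2 i 0 | i <- enum 'I_n.+1]] k.
(* The n + 3 input registers hold q, alpha and the n + 1 entries of d. *)
have cqd : computes n.+3 inputd domd (fun x => x.1.1).
  by apply: eq_computes (computes_input inputd _ (isT : (0 < n.+3)%N)).
have cad : computes n.+3 inputd domd (fun x => x.1.2).
  by apply: eq_computes (computes_input inputd _ (isT : (1 < n.+3)%N)).
have cd (j : 'I_n.+1) : computes n.+3 inputd domd (fun x => x.2 j 0).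
  have hj : (j.+2 < n.+3)%N by rewrite !ltnS -ltnS.
  apply: eq_computes (computes_input inputd _ hj) => x _.
  by rewrite /inputd /= (nth_map j) ?size_enum_ord // nth_ord_enum.
have mAd : minors_computable n.+3 inputd domd (fun x => A x.1).
  by apply: minors_computable_gram => // x [dx _]; [exact: q0 | exact: a0].
have stpAd x : domd x -> strictly_totally_positive (A x.1).
  by move=> [dx _]; exact: stpA.
apply: (@hra_of_computes _ _ _ n.+3 _ _ _
  (fun i x => (invmx (A x.1) *m x.2) i 0)).
  by move=> i; apply: (computes_solution mAd stpAd) => // x [].
move=> x dx; have -> : \col_i (invmx (A x.1) *m x.2) i 0 = invmx (A x.1) *m x.2.
  by apply/matrixP => i j; rewrite mxE ord1.
by rewrite mulKVmx // (stp_unitmx stpAd).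
Qed.
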